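(* There exists a probability measure $\tilde\mu$ concentrated on $H^3=H^3(D;\mathbb{R}^3)$, invariant under the flow of the binormal curvature flow $$v_t=v_0+\int_0^t \partial_x v_r\times\partial_x^2 v_r\,\mathrm{d}r,\qquad |\partial_x v_t|^2_{\mathbb{R}^3}=1,$$ such that the following hold. (a) (Gaussian decay) There exist constants $\sigma, C>0$ such that for all $R>0$ $$\tilde\mu(\{u\in H^3:\|\partial_x^2 u\|_{L^2}^2>R\})\le C\exp(-\sigma R^2).$$ (b) (Small probability of small balls) There is a constant $C'>0$ such that for all $\epsilon>0$ $$\tilde\mu\Big(\Big\{u\in H^3:\tfrac{|u(2\pi)|^2}{4\pi^2}<\epsilon\Big\}\Big)\le C'\epsilon,\qquad \tilde\mu\Big(\Big\{u\in H^3:1-\tfrac{|u(2\pi)|^2}{4\pi^2}<\epsilon\Big\}\Big)\le C'\epsilon,$$ $$\tilde\mu(\{u\in H^3:\|\partial_x^2u\|_{L^2}^2<\epsilon\})\le C'\epsilon.$$ (c) The law of $\|\partial_x^2 u\|_{L^2}^2$ under $\tilde\mu$ is continuous with respect to the Lebesgue measure on $\mathbb{R}$, in the sense that there is a constant $C''>0$ such that for every Borel set $A\subset\mathbb{R}$ $$\tilde\mu(\{u\in H^3:\|\partial_x^2u\|_{L^2}^2\in A\})\le C''|A|.$$ (d) $\tilde\mu$ is of at least two-dimensional nature, i.e. any compact set of Hausdorff dimension smaller than two has $\tilde\mu$-measure $0$.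
   Context: $D=[0,2\pi]$, $L^2=L^2(D;\mathbb{R}^3)$, $H^k=W^{k,2}(D;\mathbb{R}^3)$; $\times$ is the cross product in $\mathbb{R}^3$; $|A|$ is the Lebesgue measure of $A$. $\tilde\mu$ is invariant under the flow of the binormal curvature flow if there is a statistically stationary solution with law $\tilde\mu$, i.e. a stochastic process $(v_t)_{t\ge0}$ on a probability space $(\Omega,\mathcal{F},\mathbb{P})$ with values in $H^3$ such that $\mathbb{P}$-a.s. its trajectory solves the binormal curvature flow equation (with $|\partial_x v_t|=1$) and the law of $v_t$ is $\tilde\mu$ for all $t\ge0$. In (d), compact sets are compact subsets of $H^3$ and the Hausdorff dimension is taken with respect to the metric of $H^3$. *)

(* Defs.v *)
From HB Require Import structures.
From mathcomp Require Import all_boot all_order all_algebra.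
From mathcomp Require Import all_classical all_reals all_analysis.
From mathcomp Require Import ring lra.

Set Implicit Arguments.
Unset Strict Implicit.
Unset Printing Implicit Defensive.

Import Order.TTheory GRing.Theory Num.Theory.
Import numFieldNormedType.Exports.

Local Open Scope classical_set_scope.
Local Open Scope ring_scope.

Section Hausdorff.
Context {R : realType} {T : metricType R}.
Implicit Types (A : set T) (s : R).

Definition diameter A : \bar R :=
  ereal_sup [set (mdist x y)%:E | x in A & y in A].

(* the empty set contributes 0, also for s = 0 *)
Definition hausdorff_gauge s A : \bar R :=
  if A == set0 then 0%E else (diameter A `^ s)%E.

Definition hausdorff_content s (delta : R) A : \bar R :=
  ereal_inf [set (\sum_(n <oo) hausdorff_gauge s (U n))%E | U in
    [set U : (set T)^nat | A `<=` \bigcup_n U n /\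
                           forall n, (diameter (U n) <= delta%:E)%E]].

Definition hausdorff_measure s A : \bar R :=
  ereal_sup [set hausdorff_content s delta A | delta in [set d : R | 0 < d]].

Definition hausdorff_dim A : \bar R :=
  ereal_inf [set s%:E | s in [set s : R | 0 <= s /\ hausdorff_measure s A = 0%E]].

End Hausdorff.

Section Vectors.
Context {R : realType}.
Implicit Types u v : 'rV[R]_3.

(* the norm provided by the library on 'rV is the sup norm *)
Definition enorm u : R := Num.sqrt (\sum_i u 0 i ^+ 2).

(* indices are added modulo 3 *)
Definition crossv u v : 'rV[R]_3 :=
  \row_(i < 3) (u 0 (i + 1) * v 0 (i + 2) - u 0 (i + 2) * v 0 (i + 1)).

End Vectors.

Section Sobolev.
Context {R : realType}.
Local Notation mu := (@lebesgue_measure R).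
Implicit Types (u g : R -> 'rV[R]_3) (phi : R -> R) (k m : nat).

Definition dom : set R := `[0, 2 * pi].

Definition vcoord u (i : 'I_3) : R -> R := fun x => u x 0 i.

Definition inL2 u := forall i, vcoord u i \_ dom \in Lfun mu 2%:E.

Definition L2normsq u : R := \int[mu]_(x in dom) (enorm (u x) ^+ 2).

Definition L2norm u : R := Num.sqrt (L2normsq u).

Definition test_function phi :=
  (forall n x, derivable (derive1n n phi) x 1) /\
  (exists a b, [/\ 0 < a, b < 2 * pi &
                   forall x, x \notin `[a, b]%R -> phi x = 0]).

Definition weak_derivative k u g := forall phi, test_function phi -> forall i,
  \int[mu]_(x in dom) (vcoord u i x * derive1n k phi x) =
  (-1) ^+ k * \int[mu]_(x in dom) (vcoord g i x * phi x).

Definition weak_derivatives k u : set (R -> 'rV[R]_3) :=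
  [set g | inL2 g /\ weak_derivative k u g].

Definition sobolev m u :=
  inL2 u /\ forall k, (k <= m)%N -> exists g, weak_derivatives k u g.

(* A representative on [0, 2 pi] of the weak derivative of order k: the
   continuous one whenever there is one (i.e. for k <= 2 if u is in H^3, by
   Sobolev embedding), so that its values at points are meaningful. *)
Definition Dx k u : R -> 'rV[R]_3 :=
  if k is 0%N then u else
  xget (xget (cst 0) (weak_derivatives k u))
       (weak_derivatives k u `&` [set g | {within dom, continuous g}]).

(* An element of H^3 is identified with its continuous representative on
   [0, 2 pi], extended by 0 to the real line. *)
Definition inH3 : set (R -> 'rV[R]_3) := [set u |
  [/\ sobolev 3 u, {within dom, continuous u} & forall x, ~ dom x -> u x = 0]].

End Sobolev.

Arguments dom R : clear implicits.

Record H3 (R : realType) := MkH3 {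
  H3fun :> R -> 'rV[R]_3 ;
  H3funP : inH3 H3fun }.

Section H3_metric.
Context {R : realType}.
Local Notation mu := (@lebesgue_measure R).

HB.instance Definition _ := gen_eqMixin (H3 R).
HB.instance Definition _ := gen_choiceMixin (H3 R).

(* By linearity of the weak derivative this is the H^3 norm of u - w. *)
Definition H3dist (u w : H3 R) : R :=
  Num.sqrt (\sum_(k < 4) L2normsq (fun x => Dx k u x - Dx k w x)).

Lemma H3_eq (u w : H3 R) : H3fun u = H3fun w -> u = w.
Proof.
case: u w => [u Pu] [w Pw] /= uw; rewrite uw in Pu *.
by congr MkH3; exact: Prop_irrelevance.
Qed.

Lemma measurable_dom : measurable (dom R).
Proof. exact: measurable_itv. Qed.

Lemma vcoord0 : vcoord (cst (0 : 'rV[R]_3)) = fun=> cst 0.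
Proof. by apply/funext => i; apply/funext => x; rewrite /vcoord mxE. Qed.

Lemma inL2_0 : inL2 (cst (0 : 'rV[R]_3)).
Proof.
move=> i; rewrite vcoord0 (_ : _ \_ _ = cst 0); last first.
  by apply/funext => x; rewrite patchE; case: ifP.
rewrite inE; apply/andP; split; rewrite inE/=; first exact: measurable_cst.
by apply: (@finite_norm_cst0 _ _ _ mu 2%:E); rewrite lee1n.
Qed.

Lemma inL2B (f g : R -> 'rV[R]_3) :
  inL2 f -> inL2 g -> inL2 (fun x => f x - g x).
Proof.
move=> hf hg i.
rewrite (_ : _ \_ _ = (vcoord f i \_ (dom R)) \- (vcoord g i \_ (dom R))).
  have l12 : (1 <= 2%:E :> \bar R)%E by rewrite lee1n.
  exact: (rpredB (S := Lfun mu 2%:E)).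
apply/funext => x; rewrite /= 3!patchE /vcoord; case: ifP => _; first by rewrite !mxE.
by rewrite subr0.
Qed.

Lemma integrable_coordM (f g : R -> 'rV[R]_3) i : inL2 f -> inL2 g ->
  mu.-integrable (dom R) (EFin \o (fun x => f x 0 i * g x 0 i)).
Proof.
move=> hf hg; apply/integrable_mkcond; first exact: measurable_dom.
have /Lfun1_integrable := Lfun2_mul_Lfun1 (hf i) (hg i).
congr (mu.-integrable _ _); apply/funext => x /=.
by rewrite !patchE; case: ifP => _ //=; rewrite mulr0.
Qed.


Lemma enormC (v w : 'rV[R]_3) : enorm (v - w) = enorm (w - v).
Proof.
by rewrite /enorm; under eq_bigr => i _ do rewrite -opprB mxE sqrrN.
Qed.

Lemma L2normsqC (f g : R -> 'rV[R]_3) :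
  L2normsq (fun x => f x - g x) = L2normsq (fun x => g x - f x).
Proof.
by rewrite /L2normsq; apply: eq_Rintegral => x _; rewrite enormC.
Qed.

Definition L2dot (f g : R -> 'rV[R]_3) : R :=
  \int[mu]_(x in dom R) (\sum_i f x 0 i * g x 0 i).

Lemma L2normsqE (f : R -> 'rV[R]_3) : L2normsq f = L2dot f f.
Proof.
apply: eq_Rintegral => x _; rewrite /enorm sqr_sqrtr.
  by apply: eq_bigr => i _; rewrite expr2.
by apply: sumr_ge0 => i _; rewrite sqr_ge0.
Qed.

Lemma integrable_dot (f g : R -> 'rV[R]_3) : inL2 f -> inL2 g ->
  mu.-integrable (dom R) (EFin \o (fun x => \sum_i f x 0 i * g x 0 i)).
Proof.
move=> hf hg.
rewrite (_ : _ \o _ = fun x => (\sum_(i < 3) (f x 0 i * g x 0 i)%:E)%E).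
  apply: integrable_sum => [|i _]; first exact: measurable_dom.
  exact: integrable_coordM.
by apply/funext => x /=; rewrite sumEFin.
Qed.

Lemma L2normsq_ge0 (f : R -> 'rV[R]_3) : 0 <= L2normsq f.
Proof. by apply: Rintegral_ge0 => x _; rewrite sqr_ge0. Qed.

Lemma L2normsq_lin (f g : R -> 'rV[R]_3) (t : R) : inL2 f -> inL2 g ->
  L2normsq (fun x => f x + t *: g x) =
  L2normsq f + t * (2 * L2dot f g) + t ^+ 2 * L2normsq g.
Proof.
move=> hf hg; have mD := measurable_dom.
have iff := integrable_dot hf hf; have ifg := integrable_dot hf hg.
have igg := integrable_dot hg hg.
have iZ (a : R) h : mu.-integrable (dom R) (EFin \o h) ->
    mu.-integrable (dom R) (EFin \o (fun x => a * h x)).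
  by move=> ih; rewrite (_ : _ \o _ = (fun x => (a%:E * (h x)%:E)%E))//;
    exact: integrableZl.
pose ff x : R := \sum_i f x 0 i * f x 0 i.
pose fg x : R := \sum_i f x 0 i * g x 0 i.
pose gg x : R := \sum_i g x 0 i * g x 0 i.
transitivity (\int[mu]_(x in dom R) (ff x + ((t * 2) * fg x + t ^+ 2 * gg x))).
  rewrite L2normsqE; apply: eq_Rintegral => x _ /=.
  rewrite !mulr_sumr -!big_split /=; apply: eq_bigr => i _.
  by rewrite !mxE; ring.
have iZ1 := iZ (t * 2) fg ifg; have iZ2 := iZ (t ^+ 2) gg igg.
rewrite RintegralD//; last first.
  exact: (@integrableD _ _ _ mu (dom R) mD _ _ iZ1 iZ2).
rewrite RintegralD//.
by rewrite !RintegralZl// !L2normsqE mulrA addrA.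
Qed.

Lemma quad_triangle (a b c : R) : 0 <= a -> 0 <= c ->
  (forall t, 0 <= a + t * (2 * b) + t ^+ 2 * c) ->
  Num.sqrt (a + 2 * b + c) <= Num.sqrt a + Num.sqrt c.
Proof.
move=> a0 c0 h.
have b2 : b ^+ 2 <= a * c.
  have [c00|cn0] := eqVneq c 0.
    have [->|bn0] := eqVneq b 0; first by rewrite expr0n /= mulr_ge0.
    have := h (- (a + 1) / (2 * b)); rewrite c00 mulr0 addr0.
    rewrite mulfVK ?mulf_neq0 ?pnatr_eq0//; lra.
  have cp : 0 < c by rewrite lt_neqAle eq_sym cn0.
  have := h (- b / c).
  have -> : a + - b / c * (2 * b) + (- b / c) ^+ 2 * c = (a * c - b ^+ 2) / c.
    by field.
  by rewrite pmulr_lge0 ?invr_gt0// subr_ge0.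
have bs : b <= Num.sqrt a * Num.sqrt c.
  rewrite (le_trans (ler_norm b))// -sqrtrM// -sqrtr_sqr ler_sqrt//.
  exact: mulr_ge0.
have sac : 0 <= Num.sqrt a + Num.sqrt c by rewrite addr_ge0 ?sqrtr_ge0.
rewrite -[leRHS]ger0_norm// -sqrtr_sqr; apply: ler_wsqrtr.
rewrite sqrrD !sqr_sqrtr//; lra.
Qed.

Lemma inL2_Dx (u : H3 R) (k : 'I_4) : inL2 (Dx k u).
Proof.
case: (H3funP u) => -[u2 hu] _ _.
case: k => -[|k]//= k3; have := hu k.+1 k3; rewrite /Dx => -[g hg].
case: xgetP => [_ _ [[]]//|_].
by case: xgetP => [_ _ []//|/(_ g)].
Qed.

Lemma H3dist_xx (u : H3 R) : H3dist u u = 0.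
Proof.
rewrite /H3dist big1 ?sqrtr0// => k _.
rewrite /L2normsq /Rintegral integral0_eq// => x _.
by rewrite subrr /enorm big1 ?sqrtr0 ?expr0n// => i _; rewrite mxE expr0n.
Qed.

Lemma H3dist_sym (u w : H3 R) : H3dist u w = H3dist w u.
Proof.
rewrite /H3dist; apply: (@congr1 _ _ Num.sqrt).
by apply: eq_bigr => k _; apply: L2normsqC.
Qed.

Lemma eq_le_real (a b : R) : a = b -> a <= b.
Proof. by move=> ->. Qed.

Lemma H3dist_triangle (w u v : H3 R) : H3dist u v <= H3dist u w + H3dist w v.
Proof.
pose f (k : 'I_4) x := Dx k u x - Dx k w x.
pose g (k : 'I_4) x := Dx k w x - Dx k v x.
have f2 k : inL2 (f k) by apply: inL2B; exact: inL2_Dx.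
have g2 k : inL2 (g k) by apply: inL2B; exact: inL2_Dx.
have E t : \sum_k L2normsq (fun x => f k x + t *: g k x) =
    \sum_k L2normsq (f k) + t * (2 * \sum_k L2dot (f k) (g k))
    + t ^+ 2 * \sum_k L2normsq (g k).
  rewrite !mulr_sumr -!big_split /=; apply: eq_bigr => k _.
  by rewrite L2normsq_lin.
have E1 : \sum_(k < 4) L2normsq (fun x => Dx k u x - Dx k v x) =
    \sum_k L2normsq (f k) + 2 * (\sum_k L2dot (f k) (g k))
    + \sum_k L2normsq (g k).
  have := E 1; rewrite expr1n !mul1r; apply: etrans.
  apply: eq_bigr => k _; apply: (@congr1 _ _ L2normsq); apply/funext => x.
  by rewrite scale1r /f /g addrA subrK.
apply: le_trans (eq_le_real (congr1 Num.sqrt E1)) _.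
apply: quad_triangle => [||t].
- by apply: sumr_ge0 => k _; exact: L2normsq_ge0.
- by apply: sumr_ge0 => k _; exact: L2normsq_ge0.
apply: le_trans (eq_le_real (E t)).
by apply: sumr_ge0 => k _; exact: L2normsq_ge0.
Qed.

Lemma integral_eq0_continuous (b : R) (f : R -> R) : 0 < b ->
  {within `[0, b], continuous f} -> (forall x, 0 <= f x) ->
  \int[mu]_(x in `[0, b]) f x = 0 -> forall x, x \in `[0, b] -> f x = 0.
Proof.
move=> b0 cf f0 If0 x xb; apply/eqP; rewrite eq_le f0 andbT leNgt.
apply/negP => fx0.
have mI a c : measurable (`[a, c] : set R) by exact: measurable_itv.
have int_f : mu.-integrable `[0, b] (EFin \o f).
  by apply: continuous_compact_integrable => //; exact: segment_compact.
have If : (\int[mu]_(x in `[0%R, b]) (f x)%:E = 0)%E.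
  rewrite -[LHS]fineK ?integrable_fin_num//.
  by apply: (congr1 EFin); exact: If0.
have [e /= e0 he] : exists2 e, 0 < e &
    forall y, y \in `[0, b] -> `|x - y| < e -> f x / 2 < f y.
  move/subspace_continuousP : cf => /(_ x xb)/cvgrPdist_lt/(_ (f x / 2)).
  rewrite divr_gt0// => /(_ isT) /nbhs_ballP[e /= e0 he].
  exists e => // y yb xy; have : f x - f y < f x / 2 by exact: le_lt_trans (ler_norm _) (he y xy yb).
  lra.
pose p := Num.max 0 (x - e / 2); pose q := Num.min b (x + e / 2).
move: xb; rewrite /= in_itv /= => /andP[x0 xb].
have pq : p < q by rewrite /p /q gt_max !lt_min; apply/andP; split; apply/andP; split; lra.
have pqb : `[p, q] `<=` `[0, b].
  move=> y; rewrite /= !in_itv /= /p /q ge_max le_min.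
  by move=> /andP[/andP[-> _] /andP[-> _]].
have int_fpq : mu.-integrable `[p, q] (EFin \o f).
  by apply: integrableS int_f => //; exact: measurable_itv.
have : (\int[mu]_(y in `[p, q]) (f x / 2)%:E <= 0)%E.
  rewrite -If; apply: le_trans (_ : \int[mu]_(y in `[p, q]) (f y)%:E <= _)%E.
    apply: ge0_le_integral => //.
    - by move=> y _; rewrite lee_fin divr_ge0.
    - exact: measurable_int int_fpq.
    move=> y ypq; rewrite lee_fin ltW// he//; first exact: pqb.
    move: ypq; rewrite /= in_itv /= /p /q ge_max le_min.
    by move=> /andP[/andP[_ ?] /andP[_ ?]]; rewrite ltr_norml; apply/andP; split; lra.
  apply: ge0_subset_integral => //; first exact: measurable_int int_f.
  by move=> y _; rewrite lee_fin.
rewrite integral_cst//= lebesgue_measure_itv /= lte_fin pq -EFinB -EFinM lee_fin.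
by rewrite leNgt mulr_gt0// ?divr_gt0// subr_gt0.
Qed.

Lemma H3dist_eq0 (u w : H3 R) : H3dist u w = 0 -> u = w.
Proof.
have pi20 : 0 < 2 * pi :> R by rewrite mulr_gt0// pi_gt0.
move=> /eqP; rewrite sqrtr_eq0 big_ord_recl => le0.
have n0 : L2normsq (fun x => u x - w x) = 0.
  apply/eqP; rewrite eq_le L2normsq_ge0 andbT; apply: le_trans le0.
  by rewrite lerDl; apply: sumr_ge0 => k _; exact: L2normsq_ge0.
case: (H3funP u) (H3funP w) => _ cu u0 [_ cw w0].
apply/H3_eq/funext => x; have [xD|xD] := pselect (dom R x); last first.
  by rewrite u0// w0.
have enormsq v : enorm v ^+ 2 = \sum_i v 0 i ^+ 2 :> R.
  by rewrite /enorm sqr_sqrtr//; apply: sumr_ge0 => i _; rewrite sqr_ge0.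
have cE : {within dom R, continuous (fun x => enorm (u x - w x) ^+ 2)}.
  rewrite (_ : (fun x => _) = fun x => \sum_i (u x 0 i - w x 0 i) ^+ 2); last first.
    by apply/funext => y; rewrite enormsq; apply: eq_bigr => i _; rewrite !mxE.
  have cc (v : R -> 'rV[R]_3) i : {within dom R, continuous v} ->
      {within dom R, continuous (fun z => v z 0 i)}.
    move=> cv; move=> y; apply: (@continuous_comp (subspace (dom R)) 'rV[R]_3 R v (fun A => A 0 i) y).
      exact: cv.
    exact: coord_continuous.
  have sq i : {within dom R, continuous (fun x => (u x 0 i - w x 0 i) ^+ 2)}.
    move=> y; have cuw : {for y, continuous ((fun x => u x 0 i - w x 0 i) : subspace (dom R) -> R)}.
      by apply: continuousB; exact: cc.
    exact: (continuousM cuw cuw).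
  rewrite (_ : (fun x => _) = (fun x => (u x 0 0 - w x 0 0) ^+ 2 +
      ((u x 0 1 - w x 0 1) ^+ 2 + (u x 0 2 - w x 0 2) ^+ 2))); last first.
    by apply/funext => y; rewrite !big_ord_recl big_ord0 addr0; do ![congr (_ + _)];
      congr ((u y _ _ - w y _ _) ^+ 2); apply/val_inj.
  move=> y; exact: (continuousD (sq 0 y) (continuousD (sq 1 y) (sq 2 y))).
have := integral_eq0_continuous pi20 cE (fun x => sqr_ge0 _) n0 xD.
rewrite enormsq => /eqP; rewrite psumr_eq0; last by move=> i _; rewrite sqr_ge0.
move=> /allP h; apply/rowP => i; apply/eqP.
have := h i (mem_index_enum _); rewrite sqrf_eq0 !mxE subr_eq0.
by [].
Qed.

HB.instance Definition _ :=
  isMetric.Build R (H3 R) H3dist_xx H3dist_eq0 H3dist_sym H3dist_triangle.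

Lemma inH3_0 : inH3 (cst (0 : 'rV[R]_3)).
Proof.
split=> //; last by move=> x; exact: cvg_cst.
split; first exact: inL2_0.
move=> k _; exists (cst 0); split; first exact: inL2_0.
move=> phi _ i; rewrite vcoord0 /Rintegral !integral0_eq ?mulr0// => x _.
  by rewrite mul0r.
by rewrite mul0r.
Qed.

HB.instance Definition _ := isPointed.Build (H3 R) (MkH3 inH3_0).

End H3_metric.

Definition H3borel (R : realType) := g_sigma_algebraType (@open (H3 R)).

Section BinormalFlow.
Context {R : realType}.
Local Notation mu := (@lebesgue_measure R).

Definition bcf_rhs (u : H3 R) : R -> 'rV[R]_3 :=
  fun x => crossv (Dx 1 u x) (Dx 2 u x).

(* The integrability of the L^2 norm makes the time integral an L^2-valued
   (Bochner) integral; as v t and bcf_rhs (v r) are continuous in x, the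
   equation is required at every point x of [0, 2 pi]. *)
Definition bcf_solution (v : R -> H3 R) := forall t, 0 <= t ->
  [/\ forall x, dom R x -> enorm (Dx 1 (v t) x) ^+ 2 = 1,
      mu.-integrable `[0, t] (fun r => (L2norm (bcf_rhs (v r)))%:E) &
      forall x, dom R x -> forall i,
        mu.-integrable `[0, t] (fun r => (bcf_rhs (v r) x 0 i)%:E) /\
        v t x 0 i = v 0 x 0 i + \int[mu]_(r in `[0, t]) (bcf_rhs (v r) x 0 i)].

(* the random variables v t are only relevant for t >= 0 *)
Definition bcf_invariant (m : probability (H3borel R) R) :=
  exists (d : measure_display) (Omega : measurableType d)
         (P : probability Omega R) (v : R -> {RV P >-> H3borel R}),
    {ae P, forall omega, bcf_solution (fun t => v t omega)} /\
    forall t, 0 <= t -> forall A, measurable A -> distribution P (v t) A = m A.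

End BinormalFlow.

(* Main.v *)
Require Import Defs.
From HB Require Import structures.
From mathcomp Require Import all_boot all_order all_algebra.
From mathcomp Require Import all_classical all_reals all_analysis.
From mathcomp Require Import measurable_realfun.
From mathcomp Require Import ring lra.

(** The binormal flow has an explicit solution that moves by a mere rotation:
    the standing Hasimoto soliton.  With s = sech and t = tanh, the planar
    curve
      y |-> (2 s(y), 0, y - 2 t(y))
    has unit speed and curvature 2 s(y), which is exactly its distance to the
    third axis.  Its binormal vector times its curvature is therefore the
    velocity field of a rigid rotation with angular velocity 1 around that
    axis, and nothing else: the curve turns, with no translation and no slip
    along itself.  Restricting the shifted curve to [0, 2 pi] gives a family
    soliton a th of elements of H^3, where a is the shift and th the angle of
    the plane containing the curve, and r |-> soliton a (th + r) solves the
    equation (soliton_is_bcf_solution).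

    The measure is the law of soliton a th for a uniform on [0, 1] and th
    uniform on [0, 2 pi], independent of each other.  It is invariant since
    the flow adds a constant to the angle and a uniform angle on the circle is
    invariant under rotation (soliton_law_invariant).  The four properties
    come from the dependence of the curve on its two parameters.

    - The bending energy is the integral of the squared curvature, namely
      4 (t (2 pi + a) - t a).  It is bounded, which gives the Gaussian decay,
      and its derivative in a does not vanish on [0, 1], so that its law has
      a bounded density (soliton_law_energy).  The bound on the probability of
      a small bending energy is a special case.

    - The third coordinate is normalised as x - pi - 2 t (x + a), so that
      the endpoint satisfies |u(2 pi)|^2 = pi^2 - 4 pi t + 4 with |t| < 1.
      This lies between (pi - 2)^2 and (pi + 2)^2, hence away from both 0 and
      4 pi^2 as 2 < pi, and the events concerning the endpoint are empty for
      small eps.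

    - Locally the parameters are Lipschitz functions of the curve for the
      distance of H^3 (soliton_expanding).  A cover of a compact set by sets of
      diameters d_n thus gives a cover of its parameters by squares of area
      O(d_n^2), and these areas have an arbitrarily small sum if the set has
      Hausdorff dimension less than two (soliton_law_dim).

    The derivatives of an element of H^3 are chosen among its weak derivatives,
    so the classical derivatives of the soliton have to be recognised in them.
    They are weak derivatives by integration by parts, and a continuous weak
    derivative is unique by the fundamental lemma of the calculus of variations
    (continuous_test_eq0), which needs smooth bump functions: they are built
    from exp (- 1 / x). *)

Set Implicit Arguments.
Unset Strict Implicit.
Unset Printing Implicit Defensive.

Import Order.TTheory GRing.Theory Num.Theory.
Import numFieldNormedType.Exports.
Local Open Scope classical_set_scope.
Local Open Scope ring_scope.

(** * Hyperbolic functions *)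

Section Hyperbolic.
Context {R : realType}.
Implicit Types x y a th : R.

Definition sech x : R := 2 / (expR x + expR (- x)).
Definition tanh x : R := (expR x - expR (- x)) / (expR x + expR (- x)).

Lemma expRD_gt0 x : 0 < expR x + expR (- x).
Proof. by rewrite addr_gt0// expR_gt0. Qed.

Lemma sech_gt0 x : 0 < sech x.
Proof. by rewrite divr_gt0// expRD_gt0. Qed.

Lemma sech2 x : sech x ^+ 2 = 1 - tanh x ^+ 2.
Proof.
rewrite /sech /tanh expRN.
have e0 : expR x != 0 by rewrite gt_eqF// expR_gt0.
have := expRD_gt0 x; rewrite expRN => /lt0r_neq0 d0.
have d1 : expR x ^+ 2 + 1 != 0 by rewrite gt_eqF// ltr_wpDl// sqr_ge0.
by field; rewrite e0 d1.
Qed.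

Lemma is_derive_expRN x : is_derive x 1 (fun y => expR (- y)) (- expR (- x)).
Proof. by apply: is_derive_eq; rewrite mulrN1. Qed.

Lemma is_derive_denom x :
  is_derive x 1 (fun y => expR y + expR (- y)) (expR x - expR (- x)).
Proof. exact: (is_deriveD (is_derive_expR x) (is_derive_expRN x)). Qed.

Lemma is_derive_numer x :
  is_derive x 1 (fun y => expR y - expR (- y)) (expR x + expR (- x)).
Proof.
have := is_deriveB (is_derive_expR x) (is_derive_expRN x).
by rewrite opprK.
Qed.

Global Instance is_derive_sech x : is_derive x 1 sech (- (sech x * tanh x)).
Proof.
have d0 := lt0r_neq0 (expRD_gt0 x).
apply: (is_derive_eq (is_deriveM (is_derive_cst (2 : R) x 1)
  (@is_deriveV _ (fun y => expR y + expR (- y)) _ _ _ d0 (is_derive_denom x)))).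
rewrite /sech /tanh /GRing.scale /=.
by field; rewrite d0.
Qed.

Global Instance is_derive_tanh x : is_derive x 1 tanh (sech x ^+ 2).
Proof.
have d0 := lt0r_neq0 (expRD_gt0 x).
apply: (is_derive_eq (is_deriveM (is_derive_numer x)
  (@is_deriveV _ (fun y => expR y + expR (- y)) _ _ _ d0 (is_derive_denom x)))).
rewrite sech2 /tanh /GRing.scale /=.
by field; rewrite d0.
Qed.

Lemma tanh_sqr_lt1 x : tanh x ^+ 2 < 1.
Proof. by rewrite -subr_gt0 -sech2 exprn_gt0// sech_gt0. Qed.

Lemma tanh_abs_lt1 x : `|tanh x| < 1.
Proof. by rewrite -(@expr_lt1 _ 2)// real_normK ?num_real// tanh_sqr_lt1. Qed.

Lemma sech_le1 x : sech x <= 1.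
Proof.
have s0 := ltW (sech_gt0 x).
by rewrite -(@expr_le1 _ 2)// sech2 lerBlDr lerDl sqr_ge0.
Qed.

End Hyperbolic.

(** * The profile of the standing soliton *)

Section Jets.
Context {R : realType}.
Implicit Types x y a th : R.

(** The curve is (radial 0 (x + a) cos th, radial 0 (x + a) sin th,
    axial 0 (x + a) + height 0 x); the index k stands for the derivative of
    order k, up to the order 3 that occurs in the norm of H^3.  Keeping height
    apart makes axial bounded, hence globally Lipschitz, at every order. *)
Definition radial k y : R := match k with
  | 0 => 2 * sech y
  | 1 => - (2 * (sech y * tanh y))
  | 2 => 2 * sech y - 4 * sech y ^+ 3
  | _ => 12 * (sech y ^+ 3 * tanh y) - 2 * (sech y * tanh y)
  end.

Definition axial k y : R := match k with
  | 0 => - (2 * tanh y)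
  | 1 => - (2 * sech y ^+ 2)
  | 2 => 4 * (sech y ^+ 2 * tanh y)
  | _ => 4 * sech y ^+ 4 - 8 * (sech y ^+ 2 * tanh y ^+ 2)
  end.

Definition height k x : R := match k with 0 => x - pi | 1 => 1 | _ => 0 end.

Lemma is_derive_radial k y : (k < 3)%N ->
  is_derive y 1 (radial k) (radial k.+1 y).
Proof.
case: k => [|[|[|//]]] _; apply: is_derive_eq; rewrite /GRing.scale /=.
- ring.
- have := sech2 y; set s := sech y; set t := tanh y => h.
  transitivity (- 2 * s * s ^+ 2 + 2 * s * t ^+ 2); first by ring.
  have -> : t ^+ 2 = 1 - s ^+ 2 by rewrite h; ring.
  ring.
- ring.
Qed.

Lemma is_derive_axial k y : (k < 3)%N ->
  is_derive y 1 (axial k) (axial k.+1 y).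
Proof.
by case: k => [|[|[|//]]] _; apply: is_derive_eq; rewrite /GRing.scale /=; ring.
Qed.

Lemma is_derive_height k x : is_derive x 1 (height k) (height k.+1 x).
Proof.
case: k => [|[|k]].
- by apply: is_derive_eq; rewrite subr0.
- exact: is_derive_cst.
- exact: is_derive_cst.
Qed.

Lemma speed1 y : radial 1 y ^+ 2 + (axial 1 y + 1) ^+ 2 = 1.
Proof.
rewrite /=; have := sech2 y; set s := sech y; set t := tanh y => h.
have -> : (- (2 * (s * t))) ^+ 2 = 4 * s ^+ 2 * t ^+ 2 by ring.
have -> : t ^+ 2 = 1 - s ^+ 2 by rewrite h; ring.
ring.
Qed.

Lemma curvature_sqr y : radial 2 y ^+ 2 + axial 2 y ^+ 2 = 4 * sech y ^+ 2.
Proof.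
rewrite /=; have := sech2 y; set s := sech y; set t := tanh y => h.
have -> : (4 * (s ^+ 2 * t)) ^+ 2 = 16 * s ^+ 4 * t ^+ 2 by ring.
have -> : t ^+ 2 = 1 - s ^+ 2 by rewrite h; ring.
ring.
Qed.

(** The identity behind the whole construction: the signed curvature of the
    planar profile equals its distance to the axis of rotation. *)
Lemma signed_curvature y :
  (axial 1 y + 1) * radial 2 y - radial 1 y * axial 2 y = radial 0 y.
Proof.
rewrite /=; have := sech2 y; set s := sech y; set t := tanh y => h.
transitivity ((1 - 2 * s ^+ 2) * (2 * s - 4 * s ^+ 3) + 8 * s ^+ 3 * t ^+ 2).
  ring.
have -> : t ^+ 2 = 1 - s ^+ 2 by rewrite h; ring.
ring.
Qed.

Lemma mvt (f df : R -> R) x y : (forall z : R, is_derive z 1 f (df z)) ->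
  exists c, [/\ Num.min x y <= c, c <= Num.max x y &
              f x - f y = df c * (x - y)].
Proof.
move=> hf.
have cf a b : {within `[a, b], continuous f}.
  apply: derivable_within_continuous => z _.
  by have [] := hf z.
have [xy|yx] := leP x y.
- have [c] := MVT_segment xy (fun z _ => hf z) (cf _ _).
  rewrite in_itv /= => /andP[? ?] e; exists c; split => //.
  by rewrite -[LHS]opprB e -mulrN opprB.
- have [c] := MVT_segment (ltW yx) (fun z _ => hf z) (cf _ _).
  by rewrite in_itv /= => /andP[? ?] e; exists c.
Qed.

Lemma Rintegral_derive (f F : R -> R) a b : a <= b ->
  (forall x, is_derive x 1 F (f x)) -> continuous f ->
  \int[lebesgue_measure]_(x in `[a, b]) f x = F b - F a.
Proof.
rewrite le_eqVlt => /predU1P[->|ab] hF cf.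
  by rewrite set_itv1 Rintegral_set1 subrr.
have cF : continuous F.
  by move=> x; apply: differentiable_continuous; apply/derivable1_diffP; have [] := hF x.
rewrite /Rintegral (@continuous_FTC2 _ _ F)//.
- exact: continuous_subspaceT.
- split.
  + by move=> x _; have [] := hF x.
  + by apply: cvg_at_right_filter; exact: cF.
  + by apply: cvg_at_left_filter; exact: cF.
- by move=> x _; rewrite derive1E; have [_ ->] := hF x.
Qed.

End Jets.

(** * Test functions and weak derivatives *)

Section TestFunctions.
Context {R : realType}.
Implicit Types (x y a b c : R) (f g h phi : R -> R).

(** The factor x ^- m makes the family stable under differentiation up to
    linear combinations. *)
Definition flat m x : R := if 0 < x then x ^- m * expR (- x^-1) else 0.

Lemma flat_ge0 m x : 0 <= flat m x.
Proof.
by rewrite /flat; case: ifP => // /ltW x0; rewrite mulr_ge0 ?expR_ge0// invr_ge0 exprn_ge0.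
Qed.

Lemma flat_gt0 m x : 0 < x -> 0 < flat m x.
Proof.
by move=> x0; rewrite /flat x0 mulr_gt0 ?expR_gt0// invr_gt0 exprn_gt0.
Qed.

(** This gives the continuity of flat m at 0.  With y = 1 / x it reads
    y^(m+1) <= (m+1)^(m+1) exp y, the power m + 1 of the inequality
    y / (m+1) <= exp (y / (m+1)). *)
Lemma flat_le m x : flat m x <= m.+1%:R ^+ m.+1 * `|x|.
Proof.
rewrite /flat; case: ifP => [x0|_]; last by rewrite mulr_ge0// exprn_ge0.
rewrite gtr0_norm// expRN ler_pdivrMr ?expR_gt0// -[leLHS]mulr1.
set y := x^-1.
have y0 : 0 < y by rewrite invr_gt0.
have key : (y / m.+1%:R) ^+ m.+1 <= expR y.
  have -> : expR y = expR (y / m.+1%:R) ^+ m.+1.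
    by rewrite -expRM_natr divfK ?pnatr_eq0.
  rewrite lerXn2r ?nnegrE ?expR_ge0 ?divr_ge0 ?(ltW y0)//.
  by apply: le_trans (expR_ge1Dx _); rewrite lerDr.
have -> : x ^- m * 1 = m.+1%:R ^+ m.+1 * x * (y / m.+1%:R) ^+ m.+1.
  have xn0 : x != 0 by rewrite gt_eqF.
  rewrite /y -invfM exprVn exprMn.
  have : m.+1%:R ^+ m.+1 != 0 :> R by rewrite expf_neq0// pnatr_eq0.
  move: (m.+1%:R ^+ m.+1) => c c0; rewrite exprS.
  have xm0 : x ^+ m != 0 by rewrite expf_neq0.
  by field; rewrite xn0 xm0 c0.
by rewrite ler_wpM2l// mulr_ge0 ?exprn_ge0// ltW.
Qed.

Lemma is_derive_flat m x :
  is_derive x 1 (flat m) (flat m.+2 x - m%:R * flat m.+1 x).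
Proof.
have [x0|x0|x0] := ltrgtP x 0.
- have -> : flat m.+2 x - m%:R * flat m.+1 x = 0.
    by rewrite /flat ltNge (ltW x0)/= mulr0 subr0.
  apply: (@near_eq_is_derive _ _ _ (cst 0)) => //.
  near=> y; rewrite /flat ltNge.
  have y0 : y < 0 by near: y; exact: lt_nbhsl.
  by rewrite (ltW y0).
- have xn0 : x != 0 by rewrite gt_eqF.
  pose g y := (y^-1) ^+ m * expR (- (y^-1)).
  apply: (@near_eq_is_derive _ _ _ g) => //.
    near=> y; rewrite /flat /g.
    have -> : 0 < y by near: y; exact: lt_nbhsr.
    by rewrite exprVn.
  have hv := @is_deriveV _ (fun y => y) x 1 1 xn0 (is_derive_id x 1).
  have hX := @is_deriveX _ _ (fun y => y^-1) m x 1 _ hv.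
  have hE := @is_derive1_comp _ expR (fun y => - y^-1) x _ _
    (is_derive_expR (- x^-1)) (is_deriveN hv).
  have -> : g = (GRing.inv : R -> R) ^+ m * (expR \o (fun y => - y^-1)).
    by apply/funext => y; rewrite /g /= exprfctE.
  apply: (is_derive_eq (is_deriveM hX hE)).
  rewrite /flat x0 /GRing.scale /=; case: m {g hX} => [|m] /=.
    by rewrite !mul0r mulr0 addr0 subr0 !expr0 mul1r; field; rewrite xn0.
  rewrite exprfctE /= !exprVn -natr1.
  set E := expR _.
  have xm0 : x ^+ m != 0 by rewrite expf_neq0.
  rewrite !exprS.
  by field; rewrite xn0 xm0.
(* At 0 the difference quotient of flat m is flat m.+1. *)
- rewrite x0; apply/is_derive1_caratheodory; exists (flat m.+1); split.
  + move=> z; rewrite {2}/flat ltxx !subr0 /flat; case: ifPn => [z0|_].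
      by rewrite exprSr invfM; field; rewrite gt_eqF//= expf_neq0// gt_eqF.
    by rewrite mul0r.
  + apply/cvgrPdist_le => /= e e0; near=> z.
    rewrite {1}/flat ltxx sub0r normrN ger0_norm ?flat_ge0//.
    apply: le_trans (flat_le _ _) _; rewrite -ler_pdivlMl ?exprn_gt0//.
    rewrite -normrN -sub0r; near: z; apply/nbhs_ballP.
    exists (m.+2%:R ^- m.+2 * e) => /=; last by move=> z /ltW.
    by rewrite mulr_gt0 ?invr_gt0 ?exprn_gt0.
  + by rewrite /flat ltxx mulr0 subr0.
Unshelve. all: by end_near. Qed.

Definition smooth f := forall n x, derivable (derive1n n f) x 1.

(** This avoids closed formulas for the iterated derivatives of the bumps. *)
Lemma smooth_coind (S : set (R -> R)) :
  (forall f, S f -> exists2 f', S f' & forall x, is_derive x 1 f (f' x)) ->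
  forall f, S f -> smooth f.
Proof.
move=> hS f Sf n; suff [g Sg ->] : exists2 g, S g & derive1n n f = g.
  by move=> x; have [g' _ hg] := hS _ Sg; have [] := hg x.
elim: n => [|n [g Sg e]]; first by exists f.
have [g' Sg' hg] := hS _ Sg; exists g' => //.
rewrite derive1nS e; apply/funext => x; rewrite derive1E.
by have [_ ->] := hg x.
Qed.

(** The linear span of the products of a flat function at a and a reversed one
    at b: a class containing the bumps and stable under differentiation. *)
Inductive flat_span a b : (R -> R) -> Prop :=
| FlatGen c m n : flat_span a b (fun x => c * (flat m (x - a) * flat n (b - x)))
| FlatAdd f g : flat_span a b f -> flat_span a b g ->
    flat_span a b (fun x => f x + g x).

Lemma flat_span_derive a b f : flat_span a b f ->
  exists2 f', flat_span a b f' & forall x, is_derive x 1 f (f' x).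
Proof.
elim=> [c m n|{}f g _ [f' Sf' hf] _ [g' Sg' hg]]; last first.
  exists (fun x => f' x + g' x); first exact: FlatAdd.
  by move=> x; exact: is_deriveD.
exists (fun x => (c * (flat m.+2 (x - a) * flat n (b - x)) +
   (- c * m%:R) * (flat m.+1 (x - a) * flat n (b - x))) +
  (- c * (flat m (x - a) * flat n.+2 (b - x)) +
   (c * n%:R) * (flat m (x - a) * flat n.+1 (b - x)))).
  by do ![apply: FlatAdd|apply: FlatGen].
move=> x.
have h1 : is_derive x 1 (fun x => x - a) 1.
  by apply: is_derive_eq; rewrite subr0.
have h2 : is_derive x 1 (fun x => b - x) (- 1).
  exact: (is_derive_eq (is_deriveB (is_derive_cst b x 1) (is_derive_id x 1))
    (sub0r 1)).
have d1 := @is_derive1_comp _ (flat m) (fun y => y - a) x _ _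
  (is_derive_flat m (x - a)) h1.
have d2 := @is_derive1_comp _ (flat n) (fun y => b - y) x _ _
  (is_derive_flat n (b - x)) h2.
have d3 := is_deriveM (is_derive_cst c x 1) (is_deriveM d1 d2).
by apply: (is_derive_eq d3); rewrite /GRing.scale /=; ring.
Qed.

Definition bump a b x := flat 0 (x - a) * flat 0 (b - x).

Lemma smooth_bump a b : smooth (bump a b).
Proof.
apply: (@smooth_coind (flat_span a b) (@flat_span_derive a b)).
rewrite (_ : bump a b = fun x => 1 * (flat 0 (x - a) * flat 0 (b - x))).
  exact: FlatGen.
by apply/funext => x; rewrite mul1r.
Qed.

Lemma bump_ge0 a b x : 0 <= bump a b x.
Proof. by rewrite mulr_ge0 ?flat_ge0. Qed.

Lemma bump_gt0 a b x : a < x < b -> 0 < bump a b x.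
Proof. by move=> /andP[? ?]; rewrite mulr_gt0 ?flat_gt0 ?subr_gt0. Qed.

Lemma bump_out a b x : x \notin `[a, b] -> bump a b x = 0.
Proof.
rewrite in_itv /= negb_and -!ltNge /bump /flat !subr_gt0 => /orP[] h.
  by rewrite ltNge (ltW h) mul0r.
by rewrite [x < b]ltNge (ltW h) mulr0.
Qed.

Lemma test_function_bump a b : 0 < a -> b < 2 * pi -> test_function (bump a b).
Proof.
move=> a0 b2; split; first exact: smooth_bump.
by exists a, b; split => // x; exact: bump_out.
Qed.

Lemma pi2_gt0 : 0 < 2 * pi :> R.
Proof. by rewrite mulr_gt0// pi_gt0. Qed.

Lemma test_function_derive phi : test_function phi -> test_function phi^`()%classic.
Proof.
move=> [sphi [a [b [a0 b2 hphi]]]]; split.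
  move=> n x; have := sphi n.+1 x.
  by rewrite /derive1n iterSr.
exists a, b; split => // x xab; rewrite derive1E.
have : is_derive x 1 phi 0.
  apply: (@near_eq_is_derive _ _ _ (cst 0)) => //.
  move: xab; rewrite in_itv /= negb_and -!ltNge => /orP[h|h].
    near=> y; rewrite hphi// in_itv /= negb_and -!ltNge; apply/orP; left.
    by near: y; exact: lt_nbhsl.
  near=> y; rewrite hphi// in_itv /= negb_and -!ltNge; apply/orP; right.
  by near: y; exact: lt_nbhsr.
by case.
Unshelve. all: by end_near. Qed.

Lemma test_function_iter phi n : test_function phi -> test_function (derive1n n phi).
Proof.
by move=> h; elim: n => //= n IH; exact: test_function_derive.
Qed.

Lemma smooth_continuous phi : smooth phi -> continuous phi.
Proof.
move=> h x; apply: differentiable_continuous; apply/derivable1_diffP.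
exact: (h 0%N x).
Qed.

(** The fundamental lemma of the calculus of variations: a bump supported
    where h has a constant sign gives a nonzero integral. *)
Lemma continuous_test_eq0 h : {within dom R, continuous h} ->
  (forall phi, test_function phi ->
     \int[lebesgue_measure]_(x in dom R) (h x * phi x) = 0) ->
  forall x, dom R x -> h x = 0.
Proof.
move=> + + x xD; wlog hx : h / 0 < h x.
  move=> wl ch h0; have [|hx|//] := ltrgtP (h x) 0; last exact: wl.
  move=> hx; apply/eqP; rewrite -oppr_eq0; apply/eqP.
  apply: (wl (fun y => - h y)).
  - by rewrite oppr_gt0.
  - by move=> y; apply: continuousN; exact: ch.
  - move=> phi tphi; under eq_Rintegral do rewrite mulNr -mulN1r.
    rewrite RintegralZl ?h0 ?mulr0//; first exact: measurable_itv.
    apply: continuous_compact_integrable; first exact: segment_compact.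
    move=> y; apply: continuousM; first exact: ch.
    exact: (continuous_subspaceT (smooth_continuous tphi.1)).
move=> ch h0.
have [e /= e0 he] : exists2 e, 0 < e &
    forall y, y \in `[0, 2 * pi] -> `|x - y| < e -> 0 < h y.
  move/subspace_continuousP : ch => /(_ x xD)/cvgrPdist_lt/(_ (h x) hx).
  move=> /nbhs_ballP[e /= e0 he]; exists e => // y yb xy.
  have : h x - h y < h x := le_lt_trans (ler_norm _) (he y xy yb).
  by rewrite gtrBl.
pose p := Num.max 0 (x - e / 2); pose q := Num.min (2 * pi) (x + e / 2).
have pi20 := pi2_gt0.
move: xD; rewrite /dom /= in_itv /= => /andP[x0 xb].
have pq : p < q.
  by rewrite /p /q gt_max !lt_min; apply/andP; split; apply/andP; split; lra.
have p0 : 0 <= p by rewrite /p le_max lexx.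
have pe : x - e / 2 <= p by rewrite /p le_max lexx orbT.
have qb : q <= 2 * pi by rewrite /q ge_min lexx.
have qe : q <= x + e / 2 by rewrite /q ge_min lexx orbT.
(* [a, b] is the middle third of [p, q], so it avoids 0 and 2 pi even if x
   is one of them. *)
pose a := p + (q - p) / 3; pose b := q - (q - p) / 3.
have a0 : 0 < a by rewrite /a; lra.
have b2 : b < 2 * pi by rewrite /b; lra.
have t := test_function_bump a0 b2.
have hp y : a <= y <= b -> 0 < h y.
  move=> /andP[]; rewrite /a /b => ? ?; apply: he.
    by rewrite in_itv /=; apply/andP; split; lra.
  by rewrite ltr_norml; apply/andP; split; lra.
have cb : {within dom R, continuous (bump a b)}.
  by apply: continuous_subspaceT; exact: smooth_continuous t.1.
have cf : {within dom R, continuous (fun y => h y * bump a b y)}.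
  move=> y; apply: continuousM; [exact: ch|exact: cb].
have f0 y : 0 <= h y * bump a b y.
  have [yab|yab] := boolP (y \in `[a, b]); last by rewrite bump_out// mulr0.
  by rewrite mulr_ge0 ?bump_ge0// ltW// hp// -in_itv.
have := integral_eq0_continuous pi20 cf f0 (h0 _ t).
pose m := (p + q) / 2.
have mab : a < m < b by rewrite /m /a /b; apply/andP; split; lra.
have mD : m \in `[0, 2 * pi].
  by move: mab; rewrite /a /b in_itv /= => /andP[? ?]; apply/andP; split; lra.
have hm : 0 < h m by apply: hp; move: mab => /andP[? ?]; apply/andP; split; lra.
by move=> /(_ m mD)/eqP; rewrite gt_eqF// mulr_gt0// bump_gt0.
Qed.

(** Integration by parts; the boundary terms vanish as the support of a test
    function is a compact subset of the open interval. *)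
Lemma weak_derivative_iter (F : nat -> R -> R) k phi :
  (forall j x, (j < k)%N -> is_derive x 1 (F j) (F j.+1 x)) ->
  continuous (F k) -> test_function phi ->
  \int[lebesgue_measure]_(x in dom R) (F 0%N x * derive1n k phi x) =
  (-1) ^+ k * \int[lebesgue_measure]_(x in dom R) (F k x * phi x).
Proof.
elim: k F => [|k IH] F hF cF tphi; first by rewrite expr0 mul1r.
have tk := test_function_iter k tphi.
have pi20 := pi2_gt0.
have cont f f' : (forall x, is_derive x 1 f (f' x)) -> continuous f.
  move=> hf x; apply: differentiable_continuous; apply/derivable1_diffP.
  by have [] := hf x.
have c1 : continuous (F 1%N).
  case: k {IH tk} hF cF => // k hF _; apply: (cont _ (F 2%N)) => x.
  exact: hF.
have cp := smooth_continuous tk.1.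
have cp' := smooth_continuous (test_function_derive tk).1.
have dLR f : continuous f -> (forall x, derivable f x 1) ->
    derivable_oo_LRcontinuous f 0 (2 * pi).
  move=> cf hf; split.
  - by move=> x _; exact: hf.
  - by apply: cvg_at_right_filter; exact: cf.
  - by apply: cvg_at_left_filter; exact: cf.
rewrite derive1nS /dom (@Rintegration_by_parts _ (F 0%N) (derive1n k phi) (F 1%N))//; first last.
- by apply: dLR; [exact: cp|move=> x; exact: (tk.1 0%N x)].
- exact: continuous_subspaceT.
- by move=> x _; rewrite derive1E; have [_ ->] := hF 0%N x isT.
- apply: dLR; first by apply: (cont _ (F 1%N)) => z; exact: hF.
  by move=> x; have [] := hF 0%N x isT.
- exact: continuous_subspaceT.
have [_ [a [b [a0 b2 hab]]]] := tk.
rewrite (hab 0) ?(hab (2 * pi)) ?in_itv /= ?negb_and -?ltNge ?a0 ?b2 ?orbT//.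
rewrite !mulr0 subrr sub0r exprS mulN1r mulNr; congr (- _).
apply: (IH (fun j => F j.+1)) => // j x jk; exact: hF.
Qed.

End TestFunctions.

(** * Bounded Lipschitz functions *)

Arguments radial : simpl never.
Arguments axial : simpl never.
Arguments height : simpl never.

Section Lipschitz.
Context {R : realType}.
Implicit Types (x y a b c : R) (f g : R -> R).

(** Lipschitz functions alone are not stable under products; bounded ones are,
    so this class contains the polynomials in sech and tanh. *)
Definition bounded_lipschitz f := exists L : R, [/\ 0 <= L, forall x, `|f x| <= L &
  forall x y, `|f x - f y| <= L * `|x - y|].

Lemma bounded_lipschitz_cst c : bounded_lipschitz (fun=> c).
Proof.
by exists `|c|; split => // x y; rewrite subrr normr0 mulr_ge0.
Qed.

Lemma bounded_lipschitzD f g : bounded_lipschitz f -> bounded_lipschitz g ->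
  bounded_lipschitz (fun x => f x + g x).
Proof.
move=> [L [L0 fL fl]] [M [M0 gM gl]]; exists (L + M); split.
- exact: addr_ge0.
- by move=> x; rewrite (le_trans (ler_normD _ _))// lerD.
- move=> x y; rewrite opprD addrACA (le_trans (ler_normD _ _))//.
  by rewrite mulrDl lerD.
Qed.

Lemma bounded_lipschitzM f g : bounded_lipschitz f -> bounded_lipschitz g ->
  bounded_lipschitz (fun x => f x * g x).
Proof.
move=> [L [L0 fL fl]] [M [M0 gM gl]].
have LM := mulr_ge0 L0 M0.
exists (2 * (L * M)); split.
- by rewrite mulr_ge0.
- move=> x; rewrite normrM; apply: (@le_trans _ _ (L * M)); first by rewrite ler_pM.
  lra.
- move=> x y.
  have -> : f x * g x - f y * g y = (f x - f y) * g x + f y * (g x - g y) by ring.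
  rewrite (le_trans (ler_normD _ _))// !normrM.
  have -> : 2 * (L * M) * `|x - y| = L * `|x - y| * M + L * (M * `|x - y|) by ring.
  by rewrite lerD// ler_pM// mulr_ge0.
Qed.

Lemma bounded_lipschitzN f : bounded_lipschitz f ->
  bounded_lipschitz (fun x => - f x).
Proof.
move=> /(bounded_lipschitzM (bounded_lipschitz_cst (-1))).
by under [X in bounded_lipschitz X]eq_fun do rewrite mulN1r.
Qed.

Lemma bounded_lipschitzX f n : bounded_lipschitz f ->
  bounded_lipschitz (fun x => f x ^+ n).
Proof.
move=> hf; elim: n => [|n IH].
  by under [X in bounded_lipschitz X]eq_fun do rewrite expr0; exact: bounded_lipschitz_cst.
by under [X in bounded_lipschitz X]eq_fun do rewrite exprS; exact: bounded_lipschitzM.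
Qed.

Lemma bounded_lipschitz_derive f f' : (forall x, is_derive x 1 f (f' x)) ->
  (forall x, `|f x| <= 1) -> (forall x, `|f' x| <= 1) -> bounded_lipschitz f.
Proof.
move=> hf f1 f'1; exists 1; split => // x y.
by have [c [_ _ ->]] := mvt x y hf; rewrite normrM ler_wpM2r.
Qed.

Lemma bounded_lipschitz_continuous f : bounded_lipschitz f -> continuous f.
Proof.
move=> [L [L0 _ fl]] x; have L1 : 0 < L + 1 by lra.
apply/cvgrPdist_le => /= e e0; near=> y.
apply: (le_trans (fl _ _)); apply: (@le_trans _ _ ((L + 1) * `|x - y|)).
  by rewrite ler_wpM2r// lerDl.
rewrite -ler_pdivlMl//; near: y; apply/nbhs_ballP.
exists ((L + 1)^-1 * e); first by rewrite /= mulr_gt0 ?invr_gt0.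
by move=> y; rewrite /ball /= => /ltW.
Unshelve. all: by end_near. Qed.

Lemma bounded_lipschitz_sech : bounded_lipschitz (@sech R).
Proof.
apply: (bounded_lipschitz_derive is_derive_sech) => x.
  by rewrite gtr0_norm ?sech_gt0// sech_le1.
rewrite normrN normrM gtr0_norm ?sech_gt0//.
by rewrite mulr_ile1 ?sech_le1// ltW ?sech_gt0 ?tanh_abs_lt1.
Qed.

Lemma bounded_lipschitz_tanh : bounded_lipschitz (@tanh R).
Proof.
apply: (bounded_lipschitz_derive is_derive_tanh) => x.
  by rewrite ltW// tanh_abs_lt1.
by rewrite ger0_norm ?sqr_ge0// expr_le1 ?sech_le1 ?ltW ?sech_gt0.
Qed.

Lemma bounded_lipschitz_cos : bounded_lipschitz (@cos R).
Proof.
apply: (bounded_lipschitz_derive (@is_derive_cos R)) => x; first exact: cos_max.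
by rewrite normrN sin_max.
Qed.

Lemma bounded_lipschitz_sin : bounded_lipschitz (@sin R).
Proof.
by apply: (bounded_lipschitz_derive (@is_derive_sin R)) => x;
  [exact: sin_max|exact: cos_max].
Qed.

Ltac bounded_lipschitz_tac := do ![exact: bounded_lipschitz_sech|exact: bounded_lipschitz_tanh
  |exact: bounded_lipschitz_cst|apply: bounded_lipschitzX
  |apply: bounded_lipschitzN|apply: bounded_lipschitzM|apply: bounded_lipschitzD].

Lemma bounded_lipschitz_radial k : bounded_lipschitz (@radial R k).
Proof. by case: k => [|[|[|k]]]; rewrite /radial /axial; bounded_lipschitz_tac. Qed.

Lemma bounded_lipschitz_axial k : bounded_lipschitz (@axial R k).
Proof. by case: k => [|[|[|k]]]; rewrite /radial /axial; bounded_lipschitz_tac. Qed.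

End Lipschitz.

(** * Integrals of continuous functions over the domain *)

Section ContinuousOnDomain.
Context {R : realType}.
Local Notation mu := (@lebesgue_measure R).
Implicit Types (f g : R -> R).

Lemma integrable_dom f : {within dom R, continuous f} ->
  mu.-integrable (dom R) (EFin \o f).
Proof.
by move=> cf; apply: continuous_compact_integrable => //; exact: segment_compact.
Qed.

Lemma mu_dom : mu (dom R) = (2 * pi)%:E.
Proof. by rewrite /dom lebesgue_measure_itv /= lte_fin pi2_gt0 -EFinB subr0. Qed.

Lemma Rintegral_dom_le f M : {within dom R, continuous f} ->
  (forall x, dom R x -> f x <= M) -> \int[mu]_(x in dom R) f x <= M * (2 * pi).
Proof.
move=> cf fM; have -> : 2 * pi = fine (mu (dom R)) by rewrite mu_dom.
rewrite -Rintegral_cst; last exact: measurable_dom.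
apply: le_Rintegral => //; first exact: measurable_dom.
- exact: integrable_dom.
- by apply: integrable_dom; exact: continuous_subspaceT (@cst_continuous _ _ _).
Qed.

Lemma Rintegral_dom_ge f M : {within dom R, continuous f} ->
  (forall x, dom R x -> M <= f x) -> M * (2 * pi) <= \int[mu]_(x in dom R) f x.
Proof.
move=> cf fM; have -> : 2 * pi = fine (mu (dom R)) by rewrite mu_dom.
rewrite -Rintegral_cst; last exact: measurable_dom.
apply: le_Rintegral => //; first exact: measurable_dom.
- by apply: integrable_dom; exact: continuous_subspaceT (@cst_continuous _ _ _).
- exact: integrable_dom.
Qed.

Lemma continuous_Lfun2 f : continuous f -> f \_ (dom R) \in Lfun mu 2%:E.
Proof.
move=> cf; have mf := continuous_measurable_fun cf.
have md := @measurable_dom R.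
rewrite inE; apply/andP; split; rewrite inE /=.
    by apply: (proj1 (measurable_restrictT f md)); exact: measurable_funTS.
rewrite /finite_norm unlock; apply: poweR_lty.
have -> : (\int[mu]_x (`|(EFin \o f \_ (dom R)) x| `^ 2) =
    \int[mu]_x ((fun x => (f x ^+ 2)%:E) \_ (dom R)) x)%E.
  apply: eq_integral.
  move=> x _; rewrite /= !patchE; case: ifP => _.
    by rewrite powR_mulrn// real_normK ?num_real.
  by rewrite normr0 powR_mulrn// expr0n.
rewrite -integral_mkcond.
have : mu.-integrable (dom R) (EFin \o (fun x => f x ^+ 2)).
  apply: integrable_dom; apply: continuous_subspaceT => x.
  exact: (continuousM (cf x) (cf x)).
move=> /integrableP[_ h]; apply: le_lt_trans h; rewrite le_eqVlt.
apply/orP; left; apply/eqP; apply: eq_integral => x _ /=.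
by rewrite ger0_norm ?sqr_ge0.
Qed.

End ContinuousOnDomain.

(** * The soliton as an element of the Sobolev space *)

Section Soliton.
Context {R : realType}.
Local Notation mu := (@lebesgue_measure R).
Implicit Types (a th x : R) (i : 'I_3).

Definition profile k a th x : 'rV[R]_3 := \row_(i < 3)
  match val i with
  | 0 => radial k (x + a) * cos th
  | 1 => radial k (x + a) * sin th
  | _ => axial k (x + a) + height k x
  end.

Lemma ord3P (P : 'I_3 -> Prop) :
  P (@Ordinal 3 0 isT) -> P (@Ordinal 3 1 isT) -> P (@Ordinal 3 2 isT) ->
  forall i, P i.
Proof.
move=> h0 h1 h2 [[|[|[|//]]] h].
- by rewrite (_ : Ordinal h = @Ordinal 3 0 isT)//; exact: val_inj.
- by rewrite (_ : Ordinal h = @Ordinal 3 1 isT)//; exact: val_inj.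
- by rewrite (_ : Ordinal h = @Ordinal 3 2 isT)//; exact: val_inj.
Qed.

Lemma sum3 (F : 'I_3 -> R) : \sum_i F i =
  F (@Ordinal 3 0 isT) + F (@Ordinal 3 1 isT) + F (@Ordinal 3 2 isT).
Proof.
rewrite !big_ord_recl big_ord0 addr0 addrA.
by do ![congr (_ + _)]; congr F; exact: val_inj.
Qed.

Lemma is_derive_comp_shift (f : R -> R) (f' : R -> R) a x :
  (forall y : R, is_derive y 1 f (f' y)) ->
  is_derive x 1 (fun y => f (y + a)) (f' (x + a)).
Proof.
move=> hf.
have h1 : is_derive x 1 (fun y => y + a) 1.
  by apply: is_derive_eq; rewrite addr0.
have := @is_derive1_comp _ f (fun y => y + a) x _ _ (hf (x + a)) h1.
by rewrite mulr1.
Qed.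

Lemma vcoord_profile0 k a th : vcoord (profile k a th) (@Ordinal 3 0 isT) =
  fun x => radial k (x + a) * cos th.
Proof. by apply/funext => x; rewrite /vcoord mxE. Qed.

Lemma vcoord_profile1 k a th : vcoord (profile k a th) (@Ordinal 3 1 isT) =
  fun x => radial k (x + a) * sin th.
Proof. by apply/funext => x; rewrite /vcoord mxE. Qed.

Lemma vcoord_profile2 k a th : vcoord (profile k a th) (@Ordinal 3 2 isT) =
  fun x => axial k (x + a) + height k x.
Proof. by apply/funext => x; rewrite /vcoord mxE. Qed.

Definition vcoord_profileE :=
  (vcoord_profile0, vcoord_profile1, vcoord_profile2).

Lemma is_derive_profile k a th i x : (k < 3)%N ->
  is_derive x 1 (vcoord (profile k a th) i) (vcoord (profile k.+1 a th) i x).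
Proof.
move=> k3.
have hr := @is_derive_comp_shift _ _ a x (fun y => is_derive_radial y k3).
have ha := @is_derive_comp_shift _ _ a x (fun y => is_derive_axial y k3).
have hh := is_derive_height k x.
move: i; apply: ord3P; rewrite !vcoord_profileE.
- apply: (is_derive_eq (is_deriveM hr (is_derive_cst (cos th) x 1))).
  by rewrite scaler0 add0r mulrC.
- apply: (is_derive_eq (is_deriveM hr (is_derive_cst (sin th) x 1))).
  by rewrite scaler0 add0r mulrC.
- exact: is_deriveD.
Qed.

Lemma continuous_profile k a th i : continuous (vcoord (profile k a th) i).
Proof.
have shift_cont (f : R -> R) : continuous f -> continuous (fun y => f (y + a)).
  move=> cf x; apply: (@continuous_comp _ _ _ (fun y => y + a) f); last exact: cf.
  by apply: continuousD => //; exact: cst_continuous.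
have cr := shift_cont _ (bounded_lipschitz_continuous (bounded_lipschitz_radial k)).
have ca := shift_cont _ (bounded_lipschitz_continuous (bounded_lipschitz_axial k)).
have ch : continuous (@height R k).
  move=> x; apply: differentiable_continuous; apply/derivable1_diffP.
  by have [] := is_derive_height k x.
move: i; apply: ord3P => x; rewrite !vcoord_profileE.
- exact: (cvgM (cr x) (cvg_cst _)).
- exact: (cvgM (cr x) (cvg_cst _)).
- exact: (cvgD (ca x) (ch x)).
Qed.

Lemma inL2_profile k a th : inL2 (profile k a th).
Proof. by move=> i; apply: continuous_Lfun2; exact: continuous_profile. Qed.

Definition soliton_fun a th x : 'rV[R]_3 :=
  if x \in dom R then profile 0 a th x else 0.

Lemma soliton_fun_dom a th x : dom R x -> soliton_fun a th x = profile 0 a th x.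
Proof. by move=> xD; rewrite /soliton_fun mem_set. Qed.

Lemma weak_derivative_soliton_fun k a th : (k <= 3)%N ->
  weak_derivative k (soliton_fun a th) (profile k a th).
Proof.
move=> k3 phi tphi i.
rewrite -(@weak_derivative_iter _ (fun j => vcoord (profile j a th) i) k phi _ _ tphi).
- apply: eq_Rintegral => x; rewrite inE => xD.
  by rewrite /vcoord soliton_fun_dom.
- by move=> j x jk; apply: is_derive_profile; exact: leq_trans jk k3.
- exact: continuous_profile.
Qed.

Lemma inL2_soliton_fun a th : inL2 (soliton_fun a th).
Proof.
move=> i; rewrite (_ : _ \_ _ = vcoord (profile 0 a th) i \_ (dom R)).
  exact: inL2_profile.
apply/funext => x; rewrite !patchE; case: ifP => // xD.
by rewrite /vcoord /soliton_fun xD.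
Qed.

Lemma continuous_rV3 (f : R -> 'rV[R]_3) : (forall i, continuous (vcoord f i)) ->
  continuous f.
Proof.
move=> cf x; apply/cvg_ballP => e e0.
have h i : \forall t \near x, ball (vcoord f i x) e (vcoord f i t).
  by have /cvg_ballP := cf i x; apply.
near=> y; split=> // j i; rewrite (ord1 j); move: i; apply: ord3P; near: y; exact: h.
Unshelve. all: by end_near. Qed.

Lemma within_vcoord (D : set R) (f : R -> 'rV[R]_3) i :
  {within D, continuous f} -> {within D, continuous (vcoord f i)}.
Proof.
move=> cf x.
apply: (@continuous_comp (subspace D) 'rV[R]_3 R f (fun A => A 0 i) x).
  exact: cf.
exact: coord_continuous.
Qed.

Lemma inH3_soliton_fun a th : inH3 (soliton_fun a th).
Proof.
split.
- split; first exact: inL2_soliton_fun.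
  move=> k k3; exists (profile k a th); split; first exact: inL2_profile.
  exact: weak_derivative_soliton_fun.
- have := continuous_subspaceT (continuous_rV3 (@continuous_profile 0 a th)).
  move=> /(_ (dom R)).
  by apply: subspace_eq_continuous => x xD; rewrite /from_subspace soliton_fun_dom// -inE.
- by move=> x xD; rewrite /soliton_fun memNset.
Qed.

Definition soliton a th : H3 R := MkH3 (inH3_soliton_fun a th).

(** The difference of the chosen derivative and the classical one is continuous
    and orthogonal to all test functions, hence zero. *)
Lemma Dx_soliton k a th x : (k <= 3)%N -> dom R x ->
  Dx k (soliton a th) x = profile k a th x.
Proof.
move=> k3 xD; case: k k3 => [|k] k3; first exact: soliton_fun_dom.
rewrite /Dx; set W := _ `&` _.
have Wp : W (profile k.+1 a th).
  split; first split.
  - exact: inL2_profile.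
  - exact: weak_derivative_soliton_fun.
  - exact: continuous_subspaceT (continuous_rV3 (@continuous_profile _ _ _)).
set g := xget _ W.
have [[gL2 gw] gc] : W g by apply: xgetPex; exists (profile k.+1 a th).
apply/rowP => i; apply/eqP; rewrite -subr_eq0; apply/eqP.
have cg := @within_vcoord _ _ i gc.
have cp := continuous_subspaceT (@continuous_profile k.+1 a th i).
apply: (@continuous_test_eq0 _ (fun y => vcoord g i y - vcoord (profile k.+1 a th) i y)) => //.
  by move=> y; apply: continuousB; [exact: cg|exact: cp].
move=> phi tphi.
have cphi := continuous_subspaceT (smooth_continuous tphi.1).
under eq_Rintegral do rewrite mulrBl.
have iM (f : R -> R) : {within dom R, continuous f} ->
    mu.-integrable (dom R) (EFin \o (fun y => f y * phi y)).
  by move=> cf; apply: integrable_dom => y; apply: continuousM; [exact: cf|exact: cphi].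
rewrite RintegralB//; [|exact: measurable_dom|exact: iM|exact: iM].
apply/eqP; rewrite subr_eq0; apply/eqP.
have := gw phi tphi i.
rewrite (@weak_derivative_soliton_fun k.+1 a th k3 phi tphi i).
by move=> /mulfI -> //; rewrite signr_eq0.
Qed.

End Soliton.

(** * Speed, energy, endpoint and evolution of the soliton *)

Section Geometry.
Context {R : realType}.
Local Notation mu := (@lebesgue_measure R).
Implicit Types (a th x : R) (i : 'I_3).

Lemma dom2pi : dom R (2 * pi).
Proof. by rewrite /dom /= in_itv /= lexx ltW// pi2_gt0. Qed.

Lemma enorm_sqr (u : 'rV[R]_3) : enorm u ^+ 2 = \sum_i u 0 i ^+ 2.
Proof. by rewrite /enorm sqr_sqrtr// sumr_ge0// => i _; rewrite sqr_ge0. Qed.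

Lemma enorm_profile_sqr k a th x : enorm (profile k a th x) ^+ 2 =
  radial k (x + a) ^+ 2 + (axial k (x + a) + height k x) ^+ 2.
Proof.
rewrite enorm_sqr sum3 !mxE /= !exprMn -mulrDr cos2Dsin2 mulr1.
by [].
Qed.

Lemma soliton_speed a th x : dom R x -> enorm (Dx 1 (soliton a th) x) ^+ 2 = 1.
Proof. by move=> xD; rewrite Dx_soliton// enorm_profile_sqr speed1. Qed.

Definition energy a : R := 4 * (tanh (2 * pi + a) - tanh a).

Lemma Rintegral_sech2 a :
  \int[mu]_(x in dom R) (4 * sech (x + a) ^+ 2) = energy a.
Proof.
have hF x : is_derive x 1 (fun y => 4 * tanh (y + a)) (4 * sech (x + a) ^+ 2).
  have h := @is_derive_comp_shift _ tanh (fun y => sech y ^+ 2) a x is_derive_tanh.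
  apply: (is_derive_eq (is_deriveM (is_derive_cst (4 : R) x 1) h)).
  by rewrite scaler0 addr0.
rewrite /dom (Rintegral_derive (ltW pi2_gt0) hF); first by rewrite /energy add0r -mulrBr.
have cs : continuous (fun y => sech (y + a)).
  move=> x; apply: (@continuous_comp _ _ _ (fun y => y + a) sech).
    by apply: continuousD => //; exact: cst_continuous.
  exact: (bounded_lipschitz_continuous bounded_lipschitz_sech).
move=> x; exact: (cvgM (cvg_cst _) (cvgM (cs x) (cs x))).
Qed.

Lemma bending_energy a th : L2normsq (Dx 2 (soliton a th)) = energy a.
Proof.
rewrite -Rintegral_sech2; apply: eq_Rintegral => x; rewrite inE => xD.
by rewrite Dx_soliton// enorm_profile_sqr [height 2 x]/height addr0 curvature_sqr.
Qed.

Lemma energy_le8 a : energy a <= 8.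
Proof.
have := tanh_abs_lt1 (2 * pi + a); have := tanh_abs_lt1 a.
rewrite !ltr_norml /energy => /andP[? ?] /andP[? ?]; lra.
Qed.

(** The cosine vanishes at pi / 2 and not at 1. *)
Lemma pi_gt2 : 2 < pi :> R.
Proof.
rewrite lt_neqAle pi_ge2 andbT; apply/eqP => h.
have := cos_pihalf R; rewrite -h divff//; have := cos1_gt0 R => /[swap] ->.
by rewrite ltxx.
Qed.

Lemma endpoint_sqr a th : enorm (soliton a th (2 * pi)) ^+ 2 =
  pi ^+ 2 - 4 * pi * tanh (2 * pi + a) + 4.
Proof.
rewrite /= soliton_fun_dom; last exact: dom2pi.
rewrite enorm_profile_sqr /radial /axial /height exprMn sech2; ring.
Qed.

Lemma endpoint_bounds a th :
  (pi - 2) ^+ 2 <= enorm (soliton a th (2 * pi)) ^+ 2 <= (pi + 2) ^+ 2.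
Proof.
rewrite endpoint_sqr; have := tanh_abs_lt1 (2 * pi + a).
rewrite ltr_norml => /andP[h1 h2]; have p0 := @pi_gt0 R.
by apply/andP; split; nra.
Qed.

Lemma crossvE (u v : 'rV[R]_3) i0 : crossv u v 0 i0 =
  match val i0 with
  | 0 => u 0 (@Ordinal 3 1 isT) * v 0 (@Ordinal 3 2 isT) -
         u 0 (@Ordinal 3 2 isT) * v 0 (@Ordinal 3 1 isT)
  | 1 => u 0 (@Ordinal 3 2 isT) * v 0 (@Ordinal 3 0 isT) -
         u 0 (@Ordinal 3 0 isT) * v 0 (@Ordinal 3 2 isT)
  | _ => u 0 (@Ordinal 3 0 isT) * v 0 (@Ordinal 3 1 isT) -
         u 0 (@Ordinal 3 1 isT) * v 0 (@Ordinal 3 0 isT)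
  end.
Proof.
rewrite /crossv mxE; move: i0; apply: ord3P => /=;
  by congr (u 0 _ * v 0 _ - u 0 _ * v 0 _); exact: val_inj.
Qed.

(** The velocity of the rigid rotation with angular velocity 1 around the third
    axis, at the point of parameter x. *)
Definition spin a th x i : R :=
  match val i with
  | 0 => radial 0 (x + a) * - sin th
  | 1 => radial 0 (x + a) * cos th
  | _ => 0
  end.

Lemma bcf_rhs_soliton a th x i : dom R x -> bcf_rhs (soliton a th) x 0 i = spin a th x i.
Proof.
move=> xD; rewrite /bcf_rhs crossvE !Dx_soliton// !mxE /=.
have hk := signed_curvature (x + a).
move: i; apply: ord3P; rewrite /spin /= -?hk /height; ring.
Qed.

Lemma L2norm_bcf_rhs a th : L2norm (bcf_rhs (soliton a th)) = Num.sqrt (energy a).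
Proof.
congr Num.sqrt; rewrite -Rintegral_sech2; apply: eq_Rintegral => x.
rewrite inE => xD; rewrite enorm_sqr sum3 !bcf_rhs_soliton// /spin /=.
transitivity (radial 0 (x + a) ^+ 2 * (cos th ^+ 2 + sin th ^+ 2)); first by ring.
by rewrite cos2Dsin2 mulr1 /radial; ring.
Qed.

(** The right-hand side of the equation is the derivative of the curve with
    respect to its angle, so the solution is found by integrating it in time;
    its L^2 norm is constant in time. *)
Lemma soliton_is_bcf_solution a th : bcf_solution (fun t => soliton a (th + t)).
Proof.
move=> t t0; split.
- by move=> x xD; exact: soliton_speed.
- under [X in mu.-integrable _ X]eq_fun do rewrite L2norm_bcf_rhs.
  apply: continuous_compact_integrable; first exact: segment_compact.
  by apply: continuous_subspaceT => ?; exact: cst_continuous.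
move=> x xD i.
have csp : continuous (fun r => spin a (th + r) x i).
  have c1 : continuous (fun r => cos (th + r)).
    move=> r; apply: (@continuous_comp _ _ _ (fun y => th + y) (@cos R)).
      by apply: continuousD => //; exact: cst_continuous.
    exact: continuous_cos.
  have c2 : continuous (fun r => sin (th + r)).
    move=> r; apply: (@continuous_comp _ _ _ (fun y => th + y) (@sin R)).
      by apply: continuousD => //; exact: cst_continuous.
    exact: continuous_sin.
  move: i; apply: ord3P => r; rewrite /spin /=.
  - exact: (cvgM (cvg_cst _) (cvgN (c2 r))).
  - exact: (cvgM (cvg_cst _) (c1 r)).
  - exact: cvg_cst.
split.
  under [X in mu.-integrable _ X]eq_fun do rewrite bcf_rhs_soliton//.
  apply: continuous_compact_integrable; first exact: segment_compact.
  exact: continuous_subspaceT.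
under eq_Rintegral do rewrite bcf_rhs_soliton//.
suff hF (r : R) : is_derive r 1 (fun y => soliton a (th + y) x 0 i) (spin a (th + r) x i).
  by rewrite (Rintegral_derive t0 hF csp) addr0 [RHS]addrC subrK.
rewrite (_ : (fun y => _) = fun y => profile 0 a (th + y) x 0 i); last first.
  by apply/funext => y; rewrite /= soliton_fun_dom.
have hs : is_derive r 1 (fun y => th + y) 1 :=
  is_derive_eq (is_deriveD (is_derive_cst th r 1) (is_derive_id r 1)) (add0r 1).
have d1 := @is_derive1_comp _ (@cos R) (fun y => th + y) r _ _ (is_derive_cos _) hs.
have d2 := @is_derive1_comp _ (@sin R) (fun y => th + y) r _ _ (is_derive_sin _) hs.
move: i {csp}; apply: ord3P; rewrite /spin /=;
  under [X in is_derive _ _ X]eq_fun do rewrite mxE /=.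
- apply: (is_derive_eq (is_deriveM (is_derive_cst (radial 0 (x + a)) r 1) d1)).
  by rewrite scaler0 addr0 mulr1.
- apply: (is_derive_eq (is_deriveM (is_derive_cst (radial 0 (x + a)) r 1) d2)).
  by rewrite scaler0 addr0 mulr1.
- exact: is_derive_cst.
Qed.

End Geometry.

(** * The parametrisation is locally bi-Lipschitz *)

Section Embedding.
Context {R : realType}.
Local Notation mu := (@lebesgue_measure R).
Implicit Types (a th x : R) (i : 'I_3).

Lemma bounded_lipschitz_tensor (f g : R -> R) :
  bounded_lipschitz f -> bounded_lipschitz g ->
  exists2 L : R, 0 <= L & forall x y x' y',
    `|f x * g y - f x' * g y'| <= L * (`|x - x'| + `|y - y'|).
Proof.
move=> [L [L0 fL fl]] [M [M0 gM gl]]; exists (L * M); first exact: mulr_ge0.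
move=> x y x' y'.
have -> : f x * g y - f x' * g y' = (f x - f x') * g y + f x' * (g y - g y') by ring.
rewrite (le_trans (ler_normD _ _))// !normrM.
have -> : L * M * (`|x - x'| + `|y - y'|) =
  L * `|x - x'| * M + L * (M * `|y - y'|) by ring.
by rewrite lerD// ler_pM// mulr_ge0.
Qed.

Lemma profile_lipschitz k : exists2 L : R, 0 <= L & forall a th a' th' x i,
  `|profile k a th x 0 i - profile k a' th' x 0 i| <= L * (`|a - a'| + `|th - th'|).
Proof.
have br := @bounded_lipschitz_radial R k.
have [L0 L0p h0] := bounded_lipschitz_tensor br (@bounded_lipschitz_cos R).
have [L1 L1p h1] := bounded_lipschitz_tensor br (@bounded_lipschitz_sin R).
have [L2 [L2p _ h2]] := @bounded_lipschitz_axial R k.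
exists (L0 + L1 + L2); first by rewrite !addr_ge0.
move=> a th a' th' x; set s := `|a - a'| + `|th - th'|.
have s0 : 0 <= s by rewrite addr_ge0.
have sa : `|a - a'| <= s by rewrite lerDl.
have e : x + a - (x + a') = a - a' by ring.
apply: ord3P; rewrite !mxE /=.
- apply: (le_trans (h0 _ _ _ _)); rewrite e.
  by rewrite ler_wpM2r// -addrA lerDl addr_ge0.
- apply: (le_trans (h1 _ _ _ _)); rewrite e.
  by rewrite ler_wpM2r// addrAC lerDr addr_ge0.
- rewrite opprD addrACA subrr addr0; apply: (le_trans (h2 _ _)); rewrite e.
  apply: ler_pM => //; by rewrite lerDr addr_ge0.
Qed.

(** The integrand of the contribution of order k to the squared distance of
    H^3 between two solitons. *)
Definition gap k a th a' th' x := enorm (profile k a th x - profile k a' th' x) ^+ 2.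

Lemma gapE k a th a' th' x : gap k a th a' th' x =
  \sum_i (profile k a th x 0 i - profile k a' th' x 0 i) ^+ 2.
Proof. by rewrite /gap enorm_sqr; apply: eq_bigr => i _; rewrite !mxE. Qed.

Lemma continuous_gap k a th a' th' : continuous (gap k a th a' th').
Proof.
rewrite (_ : gap _ _ _ _ _ = fun x =>
  \sum_i (profile k a th x 0 i - profile k a' th' x 0 i) ^+ 2); last first.
  by apply/funext => x; exact: gapE.
under eq_fun do rewrite sum3 !expr2.
have c i : continuous (fun x => profile k a th x 0 i - profile k a' th' x 0 i).
  by move=> x; exact: (cvgB (@continuous_profile _ k a th i x)
    (@continuous_profile _ k a' th' i x)).
move=> x; exact: (cvgD (cvgD (cvgM (c _ x) (c _ x)) (cvgM (c _ x) (c _ x)))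
  (cvgM (c _ x) (c _ x))).
Qed.

Lemma L2normsq_Dx_soliton k a th a' th' : (k <= 3)%N ->
  L2normsq (fun x => Dx k (soliton a th) x - Dx k (soliton a' th') x) =
  \int[mu]_(x in dom R) gap k a th a' th' x.
Proof.
by move=> k3; apply: eq_Rintegral => x; rewrite inE => xD; rewrite !Dx_soliton.
Qed.

Lemma soliton_lipschitz : exists2 C : R, 0 <= C & forall a th a' th',
  H3dist (soliton a th) (soliton a' th') <= C * (`|a - a'| + `|th - th'|).
Proof.
have /choice[L hL] : forall k, exists L : R, 0 <= L /\ forall a th a' th' x i,
    `|profile k a th x 0 i - profile k a' th' x 0 i| <= L * (`|a - a'| + `|th - th'|).
  by move=> k; have [L L0 h] := profile_lipschitz k; exists L.
pose K : R := \sum_(k < 4) 3 * L k ^+ 2 * (2 * pi).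
have pi20 := @pi2_gt0 R.
exists (Num.sqrt K); first exact: sqrtr_ge0.
move=> a th a' th'; set s := `|a - a'| + `|th - th'|.
have s0 : 0 <= s by rewrite addr_ge0.
have K0 : 0 <= K.
  apply: sumr_ge0 => k _; apply: mulr_ge0; last exact: ltW.
  by rewrite mulr_ge0 ?sqr_ge0.
rewrite -[s in leRHS]ger0_norm// -sqrtr_sqr -sqrtrM// /H3dist; apply: ler_wsqrtr.
rewrite /K mulr_suml; apply: ler_sum => k _.
rewrite L2normsq_Dx_soliton; last by rewrite -ltnS.
rewrite mulrAC; apply: Rintegral_dom_le.
  exact: continuous_subspaceT (@continuous_gap _ _ _ _ _).
move=> x _; rewrite gapE.
have h i : (profile k a th x 0 i - profile k a' th' x 0 i) ^+ 2 <= L k ^+ 2 * s ^+ 2.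
  rewrite -exprMn -real_normK ?num_real// lerXn2r// ?nnegrE// ?mulr_ge0//; last exact: (hL k).2.
  exact: (hL k).1.
rewrite sum3 -mulrA (_ : 3 * _ = L k ^+ 2 * s ^+ 2 + L k ^+ 2 * s ^+ 2 + L k ^+ 2 * s ^+ 2); last by ring.
by rewrite !lerD.
Qed.

Lemma sech_ge x : 0 <= x -> expR (- x) <= sech x.
Proof.
move=> x0; rewrite /sech ler_pdivlMr ?expRD_gt0// mulrDr -!expRD.
have -> : - x + x = 0 by rewrite addNr.
have h : expR (- x + - x) <= 1 by rewrite -[leRHS]expR0 ler_expR; lra.
rewrite expR0; lra.
Qed.

Lemma sin_sqr_ge (d : R) : `|d| <= 1 -> (cos 1 * d) ^+ 2 <= sin d ^+ 2.
Proof.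
move=> d1; have [c [c1 c2]] := mvt d 0 (@is_derive_sin R).
rewrite sin0 !subr0 => ->; rewrite !exprMn ler_wpM2r ?sqr_ge0//.
have cc : `|c| <= 1.
  move: d1 c1 c2; rewrite !ler_norml => /andP[? ?].
  by case: (leP d 0) => ? ? ?; apply/andP; split; lra.
have p2 := @pi_gt2 R.
have h : cos 1 <= cos c :> R.
  have i1 : (1 : R) \in `[0, pi]%R by rewrite in_itv /=; apply/andP; split; lra.
  have i2 : `|c| \in `[0, pi]%R by rewrite in_itv /= normr_ge0 /=; lra.
  by rewrite -(cos_norm c) leNgt ltr_cos// -leNgt.
have c10 := cos1_gt0 R.
by rewrite lerXn2r// nnegrE; lra.
Qed.

(** A positive lower bound of sech at all the points x + a with x in the domain
    and a in [0, 1]. *)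
Definition modulus : R := expR (- (2 * pi + 1)).

Lemma modulus_gt0 : 0 < modulus.
Proof. exact: expR_gt0. Qed.

Lemma modulus_le_sech y : 0 <= y <= 2 * pi + 1 -> modulus <= sech y.
Proof.
move=> /andP[y0 y1]; apply: le_trans (sech_ge y0).
by rewrite ler_expR lerN2.
Qed.

(** The third coordinate separates the shifts, since the derivative of tanh is
    sech^2.  The first two separate the angles: writing D for the cosine of
    th - th', one has |p e^(i th) - q e^(i th')|^2 >= 2 p q (1 - D), and
    2 (1 - D) >= 1 - D^2 is the squared sine of th - th'.  The restriction on
    th - th' is due to the periodicity in the angle. *)
Lemma gap_ge a th a' th' x : 0 <= a <= 1 -> 0 <= a' <= 1 -> dom R x ->
  `|th - th'| <= 1 ->
  4 * (modulus * modulus * cos 1) ^+ 2 * ((a - a') ^+ 2 + (th - th') ^+ 2)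
  <= gap 0 a th a' th' x.
Proof.
move=> /andP[a0 a1] /andP[b0 b1]; rewrite /dom /= in_itv /= => /andP[x0 x1] th1.
have m0 := modulus_gt0.
have r1 : modulus <= sech (x + a) by apply: modulus_le_sech; apply/andP; split; lra.
have r2 : modulus <= sech (x + a') by apply: modulus_le_sech; apply/andP; split; lra.
have m1 : modulus <= 1 by exact: le_trans r1 (sech_le1 _).
have c10 := cos1_gt0 R; have c11 := @cos_le1 R 1.
rewrite gapE sum3 !mxE /= /radial /axial /height.
have [c [h1 h2 ht]] := mvt (x + a) (x + a') (@is_derive_tanh R).
have mc : modulus <= sech c.
  apply: modulus_le_sech; move: h1 h2.
  by case: (leP (x + a) (x + a')) => ? ? ?; apply/andP; split; lra.
have e : - (2 * tanh (x + a)) + (x - pi) - (- (2 * tanh (x + a')) + (x - pi)) =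
  - 2 * sech c ^+ 2 * (a - a').
  have -> : a - a' = x + a - (x + a') by ring.
  by rewrite -mulrA -ht; ring.
rewrite e.
set p := sech (x + a) in r1 *; set q := sech (x + a') in r2 *.
have hs : (cos 1 * (th - th')) ^+ 2 <= 2 * (1 - (cos th * cos th' + sin th * sin th')).
  apply: (le_trans (sin_sqr_ge th1)); rewrite sin2cos2 cosB.
  set C := cos th * cos th' + sin th * sin th'; have : 0 <= (1 - C) ^+ 2 by rewrite sqr_ge0.
  rewrite sqrrB expr1n mul1r; lra.
have -> : (2 * p * cos th - 2 * q * cos th') ^+ 2 + (2 * p * sin th - 2 * q * sin th') ^+ 2 =
  4 * (p ^+ 2 * (cos th ^+ 2 + sin th ^+ 2) + q ^+ 2 * (cos th' ^+ 2 + sin th' ^+ 2)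
   - 2 * (p * q) * (cos th * cos th' + sin th * sin th')) by ring.
rewrite !cos2Dsin2 !mulr1.
set D := cos th * cos th' + _ in hs *.
have m0' := ltW m0; have c10' := ltW c10.
have mm : modulus * modulus <= p * q by rewrite ler_pM.
have mm0 : 0 <= modulus * modulus by rewrite mulr_ge0.
have mm1 : modulus * modulus <= 1 by rewrite mulr_ile1.
have sc0 : 0 <= sech c by exact: le_trans m0' mc.
have k1 : (modulus * modulus * cos 1) ^+ 2 * (th - th') ^+ 2 <=
    p ^+ 2 + q ^+ 2 - 2 * (p * q) * D.
  have : 0 <= (p - q) ^+ 2 by rewrite sqr_ge0.
  rewrite sqrrB.
  suff : (modulus * modulus * cos 1) ^+ 2 * (th - th') ^+ 2 <= (p * q) * (2 * (1 - D)) by lra.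
  have -> : (modulus * modulus * cos 1) ^+ 2 * (th - th') ^+ 2 =
    (modulus * modulus) ^+ 2 * (cos 1 * (th - th')) ^+ 2 by ring.
  apply: ler_pM; rewrite ?sqr_ge0//; apply: le_trans mm.
  by rewrite expr2 ler_piMr.
have k2 : (modulus * modulus * cos 1) ^+ 2 * (a - a') ^+ 2 <=
    (sech c ^+ 2 * (a - a')) ^+ 2.
  rewrite [leRHS]exprMn ler_wpM2r ?sqr_ge0// lerXn2r ?nnegrE ?sqr_ge0//.
    by rewrite mulr_ge0.
  apply: (@le_trans _ _ (modulus * modulus)); first by rewrite ler_piMr.
  by rewrite expr2 ler_pM.
have -> : (- 2 * sech c ^+ 2 * (a - a')) ^+ 2 = 4 * (sech c ^+ 2 * (a - a')) ^+ 2 by ring.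
lra.
Qed.

(** The term of order 0 of the distance of H^3 is enough to separate the
    parameters. *)
Lemma soliton_expanding : exists2 C : R, 0 < C & forall a th a' th',
  0 <= a <= 1 -> 0 <= a' <= 1 -> `|th - th'| <= 1 ->
  `|a - a'| <= C * H3dist (soliton a th) (soliton a' th') /\
  `|th - th'| <= C * H3dist (soliton a th) (soliton a' th').
Proof.
pose c0 : R := 4 * (modulus * modulus * cos 1) ^+ 2.
have c00 : 0 < c0.
  by rewrite mulr_gt0// exprn_gt0// !mulr_gt0 ?modulus_gt0// cos1_gt0.
have pi20 := @pi2_gt0 R.
have k0 : 0 < c0 * (2 * pi) by rewrite mulr_gt0.
exists (Num.sqrt (c0 * (2 * pi)))^-1; first by rewrite invr_gt0 sqrtr_gt0.
move=> a th a' th' ha ha' hth.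
have key : Num.sqrt (c0 * (2 * pi)) * Num.sqrt ((a - a') ^+ 2 + (th - th') ^+ 2) <=
    H3dist (soliton a th) (soliton a' th').
  rewrite -sqrtrM; last exact: ltW.
  rewrite /H3dist; apply: ler_wsqrtr; rewrite big_ord_recl.
  rewrite -[leLHS]addr0 lerD//; last by apply: sumr_ge0 => k _; exact: L2normsq_ge0.
  rewrite L2normsq_Dx_soliton// mulrAC; apply: Rintegral_dom_ge.
    exact: continuous_subspaceT (@continuous_gap _ _ _ _ _).
  by move=> x xD; exact: gap_ge.
have sk : 0 < Num.sqrt (c0 * (2 * pi)) by rewrite sqrtr_gt0.
have {key} : Num.sqrt ((a - a') ^+ 2 + (th - th') ^+ 2) <=
   (Num.sqrt (c0 * (2 * pi)))^-1 * H3dist (soliton a th) (soliton a' th').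
  by rewrite mulrC ler_pdivlMr// mulrC.
move=> key; split; apply: le_trans key; rewrite -sqrtr_sqr; apply: ler_wsqrtr.
- by rewrite lerDl sqr_ge0.
- by rewrite lerDr sqr_ge0.
Qed.

End Embedding.

(** * Lebesgue measure on the line and Borel sets of the plane *)

Section PlaneAndLine.
Context {R : realType}.
Local Notation mu := (@lebesgue_measure R).
Implicit Types (a b c t x y T : R) (B : set R).

(** An open set is the union of the rational boxes that it contains. *)
Lemma open_prod_measurable (U : set (R * R)) : open U -> measurable U.
Proof.
move=> oU.
pose box (q : rat * rat * (rat * rat)) : set (R * R) :=
  `]ratr q.1.1, ratr q.1.2[%classic `*` `]ratr q.2.1, ratr q.2.2[%classic.
pose F q := if pselect (box q `<=` U) is left _ then box q else set0.
have -> : U = \bigcup_q F q.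
  apply/seteqP; split => [p Up|p [q _]]; last first.
    by rewrite /F; case: pselect => // + bp; apply.
  have /nbhs_ballP[e /= e0 he] : nbhs p U by exact: open_nbhs_nbhs.
  have rat_near z : exists q : rat * rat,
      [/\ z - e < ratr q.1, ratr q.1 < z, z < ratr q.2 & ratr q.2 < z + e].
    have [q1] := @rat_in_itvoo R (z - e) z ltac:(lra).
    have [q2] := @rat_in_itvoo R z (z + e) ltac:(lra).
    rewrite !in_itv /= => /andP[? ?] /andP[? ?].
    by exists (q1, q2).
  have [q1 [h1 h2 h3 h4]] := rat_near p.1.
  have [q2 [k1 k2 k3 k4]] := rat_near p.2.
  exists (q1, q2) => //; rewrite /F; case: pselect => [_|].
    by split; rewrite /= in_itv /=; apply/andP.
  case=> -[y1 y2] [/=]; rewrite !in_itv /= => /andP[? ?] /andP[? ?].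
  apply: he; split; rewrite /ball /= ltr_norml; apply/andP; split; lra.
apply: countable_bigcupT_measurable; first exact: countableP.
move=> q; rewrite /F; case: pselect => _ //.
by apply: measurableX; exact: measurable_itv.
Qed.

Lemma measurable_fun_shift t : measurable_fun [set: R] (fun x => x + t).
Proof. by apply: (measurable_funD (f := id) (g := cst t)). Qed.

Lemma measurable_shift t B : measurable B -> measurable ((fun x => x + t) @^-1` B).
Proof.
by move=> mB; rewrite -[X in measurable X]setTI; exact: measurable_fun_shift.
Qed.

Lemma lebesgue_measure_shift t B : measurable B ->
  mu ((fun x => x + t) @^-1` B) = mu B.
Proof.
move=> mB; apply/esym.
change (mu B = pushforward mu ((fun x => x + t) : _ -> measurableTypeR R) B).
apply: (@lebesgue_measure_unique _ (pushforward mu _) _ B mB).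
  exact: measurable_fun_shift.
move=> mt _ [[a b] _ <-].
transitivity (mu `]a - t, b - t]%classic); last first.
  congr (mu _); apply/seteqP; split => x /=; by rewrite !in_itv /= ltrBlDr lerBrDr.
rewrite !lebesgue_measure_itv /= !lte_fin ltrD2r.
by case: ifP => // _; rewrite -!EFinB opprB addrA subrK.
Qed.

Lemma uniform_probE a b (ab : a < b) B : measurable B ->
  uniform_prob ab B = ((b - a)^-1%:E * mu (B `&` `[a, b]))%E.
Proof.
move=> mB; rewrite /uniform_prob integral_uniform_pdf.
rewrite (eq_integral (fun=> (b - a)^-1%:E)); last first.
  by move=> x; rewrite inE => -[_] /=; rewrite in_itv /= /uniform_pdf => ->.
by rewrite integral_cst//; apply: measurableI.
Qed.

(** Cutting at t, the shift moves the piece [0, t[ to [T, T + t[. *)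
Lemma periodic_measure_small T B t : 0 <= t <= T -> measurable B ->
  (forall x, B (x + T) <-> B x) ->
  mu (((fun x => x + t) @^-1` B) `&` `[0, T[) = mu (B `&` `[0, T[).
Proof.
move=> /andP[t0 tT] mB pB.
pose S1 := B `&` `[0, t[%classic; pose S2 := B `&` `[t, T[%classic.
pose S3 := B `&` `[T, T + t[%classic.
have m1 : measurable S1 by apply: measurableI => //; exact: measurable_itv.
have m2 : measurable S2 by apply: measurableI => //; exact: measurable_itv.
have m3 : measurable S3 by apply: measurableI => //; exact: measurable_itv.
have -> : ((fun x => x + t) @^-1` B) `&` `[0, T[ = (fun x => x + t) @^-1` (S2 `|` S3).
  apply/seteqP; split => x /=; rewrite /S2 /S3 /= !in_itv /=.
    move=> [Bx /andP[x0 xT]]; case: (ltP (x + t) T) => h; [left|right]; split => //;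
    apply/andP; split => //; lra.
  by move=> [] [Bx /andP[h1 h2]]; split => //; apply/andP; split; lra.
rewrite lebesgue_measure_shift ?measureU//; last 2 first.
- apply/seteqP; split => x //=; rewrite /S2 /S3 /= !in_itv /=.
  by move=> [[_ /andP[_ h]] [_ /andP[h' _]]]; move: h; rewrite ltNge h'.
- exact: measurableU.
have -> : B `&` `[0, T[ = S1 `|` S2.
  apply/seteqP; split => x /=; rewrite /S1 /S2 /= !in_itv /=.
    move=> [Bx /andP[x0 xT]]; case: (ltP x t) => h; [left|right]; split => //;
    by rewrite ?x0.
  by move=> [] [Bx /andP[h1 h2]]; split => //; apply/andP; split; lra.
rewrite [in RHS]measureU//; last first.
  apply/seteqP; split => x //=; rewrite /S1 /S2 /= !in_itv /=.
  by move=> [[_ /andP[_ h]] [_ /andP[h' _]]]; move: h; rewrite ltNge h'.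
rewrite addeC; congr (_ + _)%E.
apply: etrans (_ : mu ((fun x => x + T) @^-1` S3) = _).
  by rewrite lebesgue_measure_shift.
congr (mu _).
apply/seteqP; split => x /=; rewrite /S1 /S3 /= !in_itv /= => -[/pB Bx /andP[h1 h2]];
by split => //; apply/andP; split; lra.
Qed.

(** A shift by t is an iteration of small shifts t / n. *)
Lemma periodic_measure T B t : 0 < T -> 0 <= t -> measurable B ->
  (forall x, B (x + T) <-> B x) ->
  mu (((fun x => x + t) @^-1` B) `&` `[0, T[) = mu (B `&` `[0, T[).
Proof.
move=> T0 t0 mB pB; have [n n0 tn] : exists2 n, (0 < n)%N & t / n%:R <= T.
  exists (Num.Def.archi_bound (t / T)).+1 => //.
  rewrite ler_pdivrMr// mulrC -ler_pdivrMr// ltW//.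
  have /archi_boundP/lt_le_trans : 0 <= t / T by rewrite divr_ge0// ltW.
  by apply; rewrite ler_nat.
have -> : t = n%:R * (t / n%:R) by rewrite mulrC divfK// pnatr_eq0 -lt0n.
have s0 : 0 <= t / n%:R <= T by rewrite tn andbT divr_ge0.
move: (t / n%:R) s0 => s s0 {n0 tn}.
elim: n B mB pB => [|n IH] B mB pB.
  by under [_ @^-1` _]eq_fun do rewrite mul0r addr0.
rewrite -(periodic_measure_small s0 mB pB).
rewrite -[RHS]IH.
- congr (mu (_ `&` _)); apply/seteqP; split => x /=;
  by rewrite -natr1 mulrDl mul1r addrA.
- exact: measurable_shift.
- by move=> x /=; rewrite addrAC; exact: pB.
Qed.

Lemma uniform_periodic T (T0 : 0 < T) B t : 0 <= t -> measurable B ->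
  (forall x, B (x + T) <-> B x) ->
  uniform_prob T0 ((fun x => x + t) @^-1` B) = uniform_prob T0 B.
Proof.
move=> t0 mB pB; have mBt := measurable_shift t mB.
have co A : measurable A -> mu (A `&` `[0, T]) = mu (A `&` `[0, T[).
  move=> mA; rewrite -(@setUitv1 _ _ _ _ true) ?bnd_simp ?ltW// setIUr.
  have m1 : measurable (A `&` `[0, T[) by apply: measurableI => //; exact: measurable_itv.
  have m2 : measurable (A `&` [set T]) by exact: measurableI.
  apply/eqP; rewrite eq_le; apply/andP; split; last first.
    by apply: le_measure; rewrite ?inE//; exact: measurableU.
  apply: (le_trans (measureU2 _ _ _)) => //.
  rewrite -[leRHS]adde0; apply: leeD => //.
  by rewrite -(lebesgue_measure_set1 T); apply: le_measure; rewrite ?inE.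
rewrite !uniform_probE// !co//.
by rewrite periodic_measure.
Qed.

(** An interval of length l has a trace of diameter at most l / c in the
    parameters; the trace is contained in an interval of twice this length
    centered at one of its points, whence the factor 2. *)
Lemma expanding_preimage (E : R -> R) c A : 0 < c ->
  (forall x y, 0 <= x <= 1 -> 0 <= y <= 1 -> c * `|x - y| <= `|E x - E y|) ->
  measurable (E @^-1` A) ->
  (mu ((E @^-1` A) `&` `[0%R, 1%R]) <= (2 / c)%:E * mu A)%E.
Proof.
move=> c0 hE mA.
have [->|Afin] := eqVneq (mu A) +oo%E.
  by rewrite gt0_muley ?leey// lte_fin divr_gt0.
have Afin' : ((wlength idfun)^* A)%mu \is a fin_num.
  by rewrite ge0_fin_numE ?outer_measure_ge0// ltey.
apply/lee_addgt0Pr => e e0.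
have d0 : 0 < e * c / 2 by rewrite divr_gt0// mulr_gt0.
have [_/= [F [mF AF] <-] hF] := lb_ereal_inf_adherent d0 Afin'.
have hn n : exists2 I : set R, measurable I &
    (E @^-1` F n) `&` `[0, 1] `<=` I /\ (mu I <= (2 / c)%:E * wlength idfun (F n))%E.
  have [[x0 [Fx0 x01]]|none] := pselect (exists x, F n (E x) /\ x \in `[0, 1]); last first.
    exists set0; first exact: measurable0.
    split; last by rewrite measure0 mule_ge0// ?lee_fin ?divr_ge0// ltW.
    by move=> x [Fx x01]; apply: none; exists x.
  have /ocitvP[F0|[[a b] /= ab Fab]] := mF n; first by rewrite F0 in Fx0.
  pose l := (b - a) / c.
  exists `[x0 - l, x0 + l]%classic; first exact: measurable_itv.
  rewrite Fab in Fx0 *; split.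
    move=> x []; move: Fx0; rewrite /= !in_itv /= => /andP[h1 h2] /andP[h3 h4] x1.
    have := hE x x0 x1 ltac:(by rewrite in_itv in x01).
    have : `|E x - E x0| <= b - a by rewrite ler_norml; apply/andP; split; lra.
    move=> /[swap] /le_trans /[apply]; rewrite mulrC -ler_pdivlMr// -/l ler_distl.
    by [].
  rewrite lebesgue_measure_itv wlength_itv /= !lte_fin ab.
  have l0 : 0 < l by rewrite divr_gt0// subr_gt0.
  have -> : x0 - l < x0 + l by lra.
  rewrite -!EFinB -EFinM lee_fin /l; set z := (b - a).
  by rewrite mulrAC; lra.
have /choice[I hI] : forall n, exists I : set R, measurable I /\
    ((E @^-1` F n) `&` `[0, 1] `<=` I /\ (mu I <= (2 / c)%:E * wlength idfun (F n))%E).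
  by move=> n; have [I] := hn n; exists I.
apply: (@le_trans _ _ (\sum_(n <oo) mu (I n))%E).
  apply: measure_sigma_subadditive.
  - by move=> n; have [] := hI n.
  - by apply: measurableI => //; exact: measurable_itv.
  - move=> x [/AF[n _ Fn] x01]; exists n => //.
    by have [_ [+ _]] := hI n; apply.
apply: (@le_trans _ _ (\sum_(n <oo) ((2 / c)%:E * wlength idfun (F n)))%E).
  by apply: lee_nneseries => n _ //; have [_ []] := hI n.
rewrite nneseriesZl//.
apply: (@le_trans _ _ ((2 / c)%:E * (mu A + (e * c / 2)%:E))%E).
  by rewrite lee_pmul2l ?lte_fin ?divr_gt0// ltW.
rewrite muleDr// ?leeD2l// -?EFinM ?lee_fin.
  have -> : 2 / c * (e * c / 2) = e by field; rewrite gt_eqF.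
  by [].
by rewrite fin_num_adde_defl.
Qed.

End PlaneAndLine.

(** * The law of the random soliton *)

Section SolitonMeasure.
Context {R : realType}.
Local Notation mu := (@lebesgue_measure R).
Local Notation plane := (measurableTypeR R * measurableTypeR R)%type.

Definition soliton_at (t : R) (p : plane) : H3borel R := soliton p.1 (p.2 + t).

Lemma soliton_at_open (t : R) (U : set (H3 R)) : open U ->
  open ((fun p : R * R => soliton p.1 (p.2 + t)) @^-1` U).
Proof.
have [C C0 hC] := @soliton_lipschitz R.
move=> oU; rewrite openE => p Up; rewrite /interior.
have /nbhs_ballP[e /= e0 he] : nbhs (soliton p.1 (p.2 + t)) U by exact: open_nbhs_nbhs.
have C1 : 0 < C + 1 by lra.
pose d := e / (2 * (C + 1)).
have de : (C + 1) * (d + d) = e by rewrite /d; field; rewrite gt_eqF.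
have d0 : 0 < d by rewrite divr_gt0// mulr_gt0.
apply/nbhs_ballP; exists d => //.
move=> q [/= h1 h2]; apply: he; rewrite ballEmdist /=.
apply: le_lt_trans (hC _ _ _ _) _.
have -> : p.2 + t - (q.2 + t) = p.2 - q.2 by ring.
have h : `|p.1 - q.1| + `|p.2 - q.2| < d + d by exact: ltrD.
apply: (@le_lt_trans _ _ ((C + 1) * (`|p.1 - q.1| + `|p.2 - q.2|))).
  by rewrite ler_wpM2r ?addr_ge0// lerDl.
by rewrite -de ltr_pM2l.
Qed.

Lemma measurable_soliton_at t : measurable_fun [set: plane] (soliton_at t).
Proof.
apply: (@measurability _ _ plane (H3borel R) setT (soliton_at t) (@open (H3 R))) => //.
move=> _ [U oU <-].
rewrite setTI; apply: open_prod_measurable; exact: soliton_at_open.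
Qed.

HB.instance Definition _ t :=
  isMeasurableFun.Build _ _ plane (H3borel R) (soliton_at t) (measurable_soliton_at t).

Definition shift_law : probability (measurableTypeR R) R :=
  uniform_prob (@ltr01 R).
Definition phase_law : probability (measurableTypeR R) R :=
  uniform_prob (@pi2_gt0 R).

Definition param_law : probability plane R := (shift_law \x phase_law)%E.

Definition soliton_law : probability (H3borel R) R :=
  distribution param_law (soliton_at 0).

Lemma soliton_periodic a th : soliton a (th + 2 * pi) = soliton a th :> H3 R.
Proof.
apply: H3_eq; apply/funext => x; rewrite /= /soliton_fun; case: ifP => // _.
by apply/rowP => i; rewrite !mxE mulr_natl (cosD2pi th) (sinD2pi th).
Qed.

(** For a fixed shift a, the angles of the solitons in A form a set with period
    2 pi. *)
Lemma soliton_law_invariant t A : 0 <= t -> measurable A ->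
  distribution param_law (soliton_at t) A = soliton_law A.
Proof.
move=> t0 mA; rewrite /soliton_law /distribution /pushforward /param_law /=.
rewrite /product_measure1; apply: eq_integral => a _ /=.
have mB : measurable ((soliton_at 0) @^-1` A).
  by rewrite -[X in measurable X]setTI; exact: measurable_soliton_at.
rewrite -[RHS](@uniform_periodic R (2 * pi) pi2_gt0 _ t) //.
- congr (uniform_prob _ _); apply/seteqP; split => th;
  by rewrite /xsection /= !inE /soliton_at /= addr0.
- exact: measurable_xsection.
- by move=> th; rewrite /xsection /= !inE /soliton_at /= !addr0 soliton_periodic.
Qed.

Lemma soliton_law_bcf_invariant : bcf_invariant soliton_law.
Proof.
exists _, _, param_law, soliton_at; split; last first.
  by move=> t t0 A mA; exact: soliton_law_invariant.
by apply: aeW => p; exact: soliton_is_bcf_solution.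
Qed.

Lemma soliton_lawE (A : set (H3 R)) :
  soliton_law A = param_law [set p | A (soliton p.1 p.2)].
Proof.
rewrite /soliton_law /distribution /pushforward; congr (param_law _).
by apply/seteqP; split => p; rewrite /= /soliton_at addr0.
Qed.

(** A quantity that is invariant under rotation depends on the shift only. *)
Lemma soliton_law_shift (F : H3 R -> R) (g : R -> R) A :
  (forall a th, F (soliton a th) = g a) -> continuous g -> measurable A ->
  soliton_law [set u : H3 R | A (F u)] = mu ((g @^-1` A) `&` `[0%R, 1%R]).
Proof.
move=> Fg cg mA; rewrite soliton_lawE.
have mgA : measurable (g @^-1` A).
  by rewrite -[X in measurable X]setTI; exact: (continuous_measurable_fun cg).
have -> : [set p : plane | A (F (soliton p.1 p.2))] = (g @^-1` A) `*` setT.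
  by apply/seteqP; split => p /=; rewrite Fg; [split|case].
transitivity (shift_law (g @^-1` A) * phase_law setT)%E.
  exact: product_measure1E.
rewrite (_ : phase_law setT = 1%E) ?mule1; last exact: probability_setT.
by apply: etrans (uniform_probE (@ltr01 R) mgA) _; rewrite subr0 invr1 mul1e.
Qed.

Lemma soliton_law_le1 (F : H3 R -> R) (g : R -> R) A :
  (forall a th, F (soliton a th) = g a) -> continuous g -> measurable A ->
  (soliton_law [set u : H3 R | A (F u)] <= 1)%E.
Proof.
move=> Fg cg mA; rewrite (soliton_law_shift Fg cg mA).
have mgA : measurable (g @^-1` A).
  by rewrite -[X in measurable X]setTI; exact: (continuous_measurable_fun cg).
have -> : 1%E = mu `[0%R, 1%R].
  by rewrite lebesgue_measure_itv /= lte_fin ltr01 -EFinB subr0.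
have mI : measurable (`[0%R, 1%R]%classic : set (measurableTypeR R)).
  exact: measurable_itv.
by apply: le_measure; rewrite ?inE//; exact: measurableI.
Qed.

(** The event is empty if eps <= d, and eps / d is at least 1 otherwise. *)
Lemma soliton_law_small (F : H3 R -> R) (g : R -> R) (d eps : R) :
  (forall a th, F (soliton a th) = g a) -> continuous g -> 0 < d ->
  (forall a, d <= g a) -> 0 < eps ->
  (soliton_law [set u : H3 R | (F u < eps)%R] <= (d^-1 * eps)%:E)%E.
Proof.
move=> Fg cg d0 dg e0; have [ed|de] := leP eps d.
  rewrite soliton_lawE (_ : [set p : plane | F (soliton p.1 p.2) < eps] = set0).
    by rewrite measure0 lee_fin; apply: mulr_ge0; rewrite ?invr_ge0; exact: ltW.
  apply/seteqP; split => p //=; rewrite Fg => h.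
  by have := lt_le_trans h ed; rewrite ltNge dg.
have -> : [set u : H3 R | F u < eps] = [set u : H3 R | `]-oo, eps[%classic (F u)].
  by apply/seteqP; split => u /=; rewrite in_itv.
apply: le_trans (soliton_law_le1 Fg cg _) _; first exact: measurable_itv.
by rewrite lee_fin mulrC ler_pdivlMr// mul1r ltW.
Qed.

Lemma continuous_tanh_shift (b : R) : continuous (fun a => tanh (b + a)).
Proof.
move=> x; apply: (@continuous_comp _ _ _ (fun y => b + y) tanh).
  by apply: continuousD => //; exact: cst_continuous.
exact: (bounded_lipschitz_continuous bounded_lipschitz_tanh).
Qed.

Lemma continuous_energy : continuous (@energy R).
Proof.
have ct := bounded_lipschitz_continuous (@bounded_lipschitz_tanh R).
change (continuous (fun a : R => 4 * (tanh (2 * pi + a) - tanh a))).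
move=> x; exact: (cvgM (cvg_cst _) (cvgB (@continuous_tanh_shift _ x) (ct x))).
Qed.

Lemma tanh_lt (x y : R) : x < y -> tanh x < tanh y.
Proof.
move=> xy; have [c [_ _ h]] := mvt y x (@is_derive_tanh R).
by rewrite -subr_gt0 h mulr_gt0 ?exprn_gt0 ?sech_gt0// subr_gt0.
Qed.

Lemma tanh0 : tanh 0 = 0 :> R.
Proof. by rewrite /tanh oppr0 subrr mul0r. Qed.

(** The derivative of the energy is 4 (tanh^2 a - tanh^2 (2 pi + a)), and
    tanh^2 increases on the positive axis: on [0, 1] the two terms are separated
    by their values at 1 and at 2 pi. *)
Lemma energy_expanding : exists2 c : R, 0 < c & forall x y,
  0 <= x <= 1 -> 0 <= y <= 1 -> c * `|x - y| <= `|energy x - energy y|.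
Proof.
have p2 := @pi_gt2 R.
pose c : R := 4 * (tanh (2 * pi) ^+ 2 - tanh 1 ^+ 2).
have t1 : 0 < tanh 1 :> R by rewrite -tanh0 tanh_lt.
have t12 : tanh 1 < tanh (2 * pi) :> R by rewrite tanh_lt//; lra.
have c0 : 0 < c.
  by rewrite mulr_gt0// subr_gt0 ltrXn2r// ?nnegrE ltW// (lt_trans t1).
exists c => // x y hx hy.
have hd (z : R) : is_derive z 1 (@energy R) (4 * (sech (2 * pi + z) ^+ 2 - sech z ^+ 2)).
  have hs : is_derive z 1 (fun y => 2 * pi + y) 1 :=
    is_derive_eq (is_deriveD (is_derive_cst (2 * pi) z 1) (is_derive_id z 1)) (add0r 1).
  have d1 := @is_derive1_comp _ (@tanh R) (fun y => 2 * pi + y) z _ _ (is_derive_tanh _) hs.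
  apply: (is_derive_eq (is_deriveM (is_derive_cst (4 : R) z 1) (is_deriveB d1 (is_derive_tanh z)))).
  by rewrite scaler0 addr0 mulr1.
have [z [h1 h2 ->]] := mvt x y hd.
have [z0 z1] : 0 <= z /\ z <= 1.
  move: hx hy h1 h2 => /andP[? ?] /andP[? ?].
  by case: (leP x y) => ? ? ?; split; lra.
rewrite normrM ler_wpM2r// -normrN; apply: le_trans (ler_norm _).
rewrite !sech2 /c.
have tz0 : 0 <= tanh z.
  by move: z0; rewrite le_eqVlt => /predU1P[<-|/tanh_lt/ltW]; rewrite tanh0.
have tz1 : tanh z <= tanh 1.
  by move: z1; rewrite le_eqVlt => /predU1P[->|/tanh_lt/ltW].
have tz2 : tanh (2 * pi) <= tanh (2 * pi + z).
  move: z0; rewrite le_eqVlt => /predU1P[<-|?]; first by rewrite addr0.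
  by apply/ltW/tanh_lt; lra.
have q1 : tanh z ^+ 2 <= tanh 1 ^+ 2 by rewrite lerXn2r// nnegrE ltW.
have q2 : tanh (2 * pi) ^+ 2 <= tanh (2 * pi + z) ^+ 2.
  have t20 := lt_trans t1 t12.
  by rewrite lerXn2r// nnegrE ltW// (lt_le_trans t20).
lra.
Qed.

Lemma soliton_law_energy : exists2 C : R, 0 < C & forall A, measurable A ->
  (soliton_law [set u : H3 R | A (L2normsq (Dx 2 u))] <= C%:E * mu A)%E.
Proof.
have [c c0 hc] := energy_expanding.
exists (2 / c); first by rewrite divr_gt0.
move=> A mA; rewrite (@soliton_law_shift _ energy)//.
- apply: expanding_preimage => //.
  by rewrite -[X in measurable X]setTI; exact: (continuous_measurable_fun continuous_energy).
- exact: bending_energy.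
- exact: continuous_energy.
Qed.

(** The energy is at most 8, so the event is empty if r >= 8, and the right-hand
    side is at least 1 otherwise. *)
Lemma soliton_law_gaussian (r : R) : 0 < r ->
  (soliton_law [set u : H3 R | (r < L2normsq (Dx 2 u))%R] <= (expR 64 * expR (- (1 * r ^+ 2)))%:E)%E.
Proof.
move=> r0; have [r8|r8] := leP 8 r.
  rewrite soliton_lawE (_ : [set p : plane | r < _] = set0).
    by rewrite measure0 lee_fin mulr_ge0 ?expR_ge0.
  apply/seteqP; split => p //=; rewrite bending_energy => h.
  by have := lt_le_trans h (energy_le8 _); rewrite ltNge r8.
have -> : [set u : H3 R | r < L2normsq (Dx 2 u)] =
    [set u : H3 R | `]r, +oo[%classic (L2normsq (Dx 2 u))].
  by apply/seteqP; split => u /=; rewrite in_itv /= andbT.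
apply: (le_trans (@soliton_law_le1 _ energy _ bending_energy continuous_energy _)).
  exact: measurable_itv.
rewrite lee_fin -expRD -[leLHS]expR0 ler_expR mul1r subr_ge0.
have -> : 64 = 8 ^+ 2 :> R by ring.
by rewrite lerXn2r// ?nnegrE ltW.
Qed.

Lemma soliton_law_endpoint : exists C : R, 0 < C /\ forall eps : R, 0 < eps ->
  (soliton_law [set u : H3 R | (enorm (u (2 * pi)) ^+ 2 / (4 * pi ^+ 2) < eps)%R] <=
     (C * eps)%:E)%E /\
  (soliton_law [set u : H3 R | (1 - enorm (u (2 * pi)) ^+ 2 / (4 * pi ^+ 2) < eps)%R] <=
     (C * eps)%:E)%E.
Proof.
have p2 := @pi_gt2 R.
pose g (a : R) : R := (pi ^+ 2 - 4 * pi * tanh (2 * pi + a) + 4) / (4 * pi ^+ 2).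
have q0 : 0 < 4 * pi ^+ 2 :> R by rewrite mulr_gt0// exprn_gt0// pi_gt0.
have cg : continuous g.
  move=> x; apply: (cvgM _ (cvg_cst _)); apply: (cvgD _ (cvg_cst _)).
  exact: (cvgB (cvg_cst _) (cvgM (cvg_cst _) (@continuous_tanh_shift _ x))).
have cg1 : continuous (fun a => 1 - g a).
  by move=> x; exact: (cvgB (cvg_cst _) (cg x)).
have hg a th : enorm (soliton a th (2 * pi)) ^+ 2 / (4 * pi ^+ 2) = g a.
  by rewrite endpoint_sqr.
pose d1 : R := (pi - 2) ^+ 2 / (4 * pi ^+ 2).
pose d2 : R := 1 - (pi + 2) ^+ 2 / (4 * pi ^+ 2).
have d10 : 0 < d1 by rewrite divr_gt0// exprn_gt0// subr_gt0.
have d20 : 0 < d2.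
  rewrite subr_gt0 ltr_pdivrMr// mul1r.
  have -> : 4 * pi ^+ 2 = (2 * pi) ^+ 2 :> R by ring.
  by rewrite ltrXn2r// ?nnegrE; lra.
have h1 a : d1 <= g a.
  rewrite -(hg a 0) /d1 ler_pM2r ?invr_gt0//.
  by have /andP[] := endpoint_bounds a 0.
have h2 a : d2 <= 1 - g a.
  rewrite -(hg a 0) /d2 lerD2l lerN2 ler_pM2r ?invr_gt0//.
  by have /andP[] := endpoint_bounds a 0.
exists (d1^-1 + d2^-1); split; first by rewrite addr_gt0 ?invr_gt0.
move=> eps e0; split.
- apply: le_trans (soliton_law_small hg cg d10 h1 e0) _.
  by rewrite lee_fin ler_pM2r// lerDl invr_ge0 ltW.
- apply: le_trans (@soliton_law_small (fun u : H3 R => 1 - enorm (u (2 * pi)) ^+ 2 / (4 * pi ^+ 2)) _ _ eps _ cg1 d20 h2 e0) _.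
    by move=> a th; rewrite hg.
  by rewrite lee_fin ler_pM2r// lerDr invr_ge0 ltW.
Qed.

Lemma shift_law_le A : measurable A -> (shift_law A <= mu A)%E.
Proof.
move=> mA; rewrite [leLHS](uniform_probE (@ltr01 R) mA) subr0 invr1 mul1e.
by apply: le_measure; rewrite ?inE//; apply: measurableI => //; exact: measurable_itv.
Qed.

Lemma phase_law_le A : measurable A -> (phase_law A <= mu A)%E.
Proof.
move=> mA; rewrite [leLHS](uniform_probE (@pi2_gt0 R) mA) subr0.
have p2 := @pi_gt2 R.
have mAI : measurable (A `&` `[0, 2 * pi]) by apply: measurableI => //; exact: measurable_itv.
apply: (@le_trans _ _ (mu (A `&` `[0%R, (2 * pi)%R]))).
  rewrite -[leRHS]mul1e lee_wpmul2r// lee_fin invf_le1; lra.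
by apply: le_measure; rewrite ?inE//; exact: subIsetl.
Qed.

Definition segment (x l : R) : set (measurableTypeR R) := `[x - l, x + l]%classic.

Lemma measurable_segment x l : measurable (segment x l).
Proof. exact: measurable_itv. Qed.

Lemma mu_segment (x l : R) : 0 <= l -> mu (segment x l) = (2 * l)%:E.
Proof.
move=> l0; rewrite /segment lebesgue_measure_itv /= lte_fin; case: ltP => h.
  by rewrite -EFinB; congr EFin; ring.
by congr EFin; lra.
Qed.

Lemma param_law_square (x y l : R) : 0 <= l ->
  (param_law (segment x l `*` segment y l) <=
   (4 * l ^+ 2)%:E)%E.
Proof.
move=> l0.
have mI z := @measurable_segment z l.
rewrite [leLHS](product_measure1E shift_law phase_law (mI x) (mI y)).
have -> : (4 * l ^+ 2)%:E = (mu (segment x l) * mu (segment y l))%E.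
  by rewrite !mu_segment// -EFinM; congr EFin; ring.
by apply: lee_pmul => //; [exact: shift_law_le|exact: phase_law_le].
Qed.

(** The parameters are cut into cells in which the angle varies by at most 1,
    as soliton_expanding requires. *)
Definition cell (n : nat) : set plane := `[0, 1]%classic `*` `[n%:R, n.+1%:R]%classic.

Lemma measurable_cell n : measurable (cell n).
Proof. by apply: measurableX; exact: measurable_itv. Qed.

Lemma diameter_ge (U : set (H3 R)) u w : U u -> U w -> ((H3dist u w)%:E <= diameter U)%E.
Proof. by move=> Uu Uw; apply: ereal_sup_ubound; exists u => //; exists w. Qed.

(** The parameters in a cell of the curves in U lie in a square of side
    2 C d, where d is the diameter of U; and d^2 <= d^s as d <= 1. *)
Lemma soliton_law_cell : exists2 C : R, 0 < C & forall n (U : set (H3 R)) (s : R),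
  0 <= s <= 2 -> (diameter U <= 1%:E)%E ->
  exists Q : set plane, [/\ measurable Q,
    [set p : plane | U (soliton p.1 p.2)] `&` cell n `<=` Q &
    (param_law Q <= C%:E * hausdorff_gauge s U)%E].
Proof.
have [C C0 hC] := @soliton_expanding R.
exists (4 * C ^+ 2); first by rewrite mulr_gt0// exprn_gt0.
move=> n U s /andP[s0 s2] dU.
have g0 : (0 <= hausdorff_gauge s U)%E.
  by rewrite /hausdorff_gauge; case: ifP => // _; exact: poweR_ge0.
have [[p [Up [p1 p2]]]|none] :=
    pselect (exists p : plane, U (soliton p.1 p.2) /\ cell n p); last first.
  exists set0; split => //; last by rewrite measure0 mule_ge0// lee_fin mulr_ge0// sqr_ge0.
  by move=> p [Up cp]; apply: none; exists p.
pose l := fine (diameter U).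
have d0 : (0 <= diameter U)%E.
  by apply: le_trans (diameter_ge Up Up); rewrite lee_fin H3dist_xx.
have dE : diameter U = l%:E by rewrite /l fineK// ge0_fin_numE// (le_lt_trans dU)// ltry.
have l0 : 0 <= l by rewrite -lee_fin -dE.
have l1 : l <= 1 by rewrite -lee_fin -dE.
exists (segment p.1 (C * l) `*` segment p.2 (C * l)); split.
- by apply: measurableX; exact: measurable_segment.
- move=> q [/= Uq [q1 q2]].
  have dpq : H3dist (soliton q.1 q.2) (soliton p.1 p.2) <= l.
    by rewrite -lee_fin -dE; exact: diameter_ge.
  move: p1 p2 q1 q2; rewrite /= !in_itv /= -!natr1 => p1 /andP[? ?] q1 /andP[? ?].
  have qp : `|q.2 - p.2| <= 1 by rewrite ler_norml; apply/andP; split; lra.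
  have [h1 h2] := hC _ _ _ _ q1 p1 qp.
  have hl : C * H3dist (soliton q.1 q.2) (soliton p.1 p.2) <= C * l by rewrite ler_pM2l.
  by split; rewrite /segment /= in_itv /= -ler_distl; [exact: le_trans h1 hl|exact: le_trans h2 hl].
- apply: le_trans (param_law_square _ _ _) _; first by rewrite mulr_ge0// ltW.
  rewrite /hausdorff_gauge ifF; last by apply/negbTE/set0P; exists (soliton p.1 p.2).
  rewrite dE poweR_EFin -EFinM lee_fin exprMn mulrA ler_wpM2l//.
    by rewrite mulr_ge0// sqr_ge0.
  rewrite -powR_mulrn//; have [->|ln0] := eqVneq l 0.
    by rewrite powR0 ?powR_ge0// pnatr_eq0.
  by apply: ger_powR => //; rewrite l1 andbT lt_neqAle eq_sym ln0.
Qed.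

(** In each cell the squares of a cover have a total area controlled by the
    s-dimensional Hausdorff content, which vanishes for some s < 2. *)
Lemma soliton_law_dim (K : set (H3 R)) : compact K ->
  (hausdorff_dim K < 2%:E)%E -> soliton_law K = 0%E.
Proof.
move=> cK /ereal_inf_lt[_ [s [s0 hs] <-]]; rewrite lte_fin => s2.
have s02 : 0 <= s <= 2 by rewrite s0 ltW.
have clK : closed K by apply: compact_closed => //; exact: metric_hausdorff.
have mB : measurable [set p : plane | K (soliton p.1 p.2)].
  rewrite -[X in measurable X]setCK; apply: measurableC.
  have oK : open (~` K) by exact: closed_openC.
  have := open_prod_measurable (@soliton_at_open 0 _ oK).
  by congr measurable; apply/seteqP; split => p /=; rewrite addr0.
rewrite soliton_lawE; apply: measure_negligible => //.
set B := [set p | _] in mB *.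
have [C C0 hC] := soliton_law_cell.
have nullcell n : param_law (B `&` cell n) = 0%E.
  have mBc : measurable (B `&` cell n) by apply: measurableI => //; exact: measurable_cell.
  apply/eqP; rewrite eq_le measure_ge0 andbT; apply/lee_addgt0Pr => e e0; rewrite add0e.
  have : (hausdorff_content s 1 K < (C^-1 * e)%:E)%E.
    apply: (@le_lt_trans _ _ 0%E); last by rewrite lte_fin mulr_gt0// invr_gt0.
    by rewrite -hs; apply: ereal_sup_ubound; exists 1 => //=.
  move=> /ereal_inf_lt[_ [U [KU dU] <-] hU].
  have /choice[Q hQ] k := hC n (U k) s s02 (dU k).
  apply: (@le_trans _ _ (\sum_(k <oo) param_law (Q k))%E).
    apply: measure_sigma_subadditive => //.
    - by move=> k; have [] := hQ k.
    - move=> p [Bp cp]; have [k _ Uk] := KU _ Bp; exists k => //.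
      by have [_ + _] := hQ k; apply.
  apply: (@le_trans _ _ (\sum_(k <oo) (C%:E * hausdorff_gauge s (U k)))%E).
    by apply: lee_nneseries => k _ //; have [] := hQ k.
  have g0 k : (0 <= hausdorff_gauge s (U k))%E.
    by rewrite /hausdorff_gauge; case: ifP => // _; exact: poweR_ge0.
  rewrite nneseriesZl//.
  have -> : e%:E = (C%:E * (C^-1 * e)%:E)%E.
    by rewrite -EFinM mulrA mulfV ?gt_eqF// mul1r.
  by rewrite lee_pmul2l// ltW.
pose S : set plane := `[0, 1]%classic `*` `[0, 2 * pi]%classic.
have mS : measurable S by apply: measurableX; exact: measurable_itv.
have nullS : param_law (~` S) = 0%E.
  rewrite probability_setC// [X in (_ - X)%E](_ : _ = 1%E) ?subee//.
  have mI (a b : R) : measurable (`[a, b]%classic : set (measurableTypeR R)).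
    exact: measurable_itv.
  rewrite [LHS](product_measure1E shift_law phase_law (mI 0 1) (mI 0 (2 * pi))).
  have p2 := @pi_gt2 R.
  rewrite [X in (X * _)%E](uniform_probE (@ltr01 R) (mI 0 1)).
  rewrite [X in (_ * X)%E](uniform_probE (@pi2_gt0 R) (mI 0 (2 * pi))).
  rewrite !setIid !lebesgue_measure_itv /= !lte_fin ltr01 pi2_gt0 -!EFinB !subr0 -!EFinM.
  by rewrite invr1 !mul1r mulVf// gt_eqF// pi2_gt0.
apply: (@negligibleS _ _ _ _ (~` S `|` \bigcup_n (B `&` cell n))).
  move=> p Bp; have [Sp|] := pselect (S p); last by left.
  right; move: Sp => [p1]; rewrite /= in_itv /= => /andP[p20 _].
  exists (Num.truncn p.2) => //; split => //; split => //=.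
  by rewrite in_itv /=; have /andP[-> /ltW ->] := truncn_itv p20.
apply: negligibleU; last apply: negligible_bigcup => n.
- by apply/negligibleP => //; exact: measurableC.
- apply/negligibleP; last exact: nullcell.
  by apply: measurableI => //; exact: measurable_cell.
Qed.

End SolitonMeasure.

Theorem theorem1p4 (R : realType) :
  exists m : probability (H3borel R) R,
    bcf_invariant m /\
    (exists sigma C : R, [/\ 0 < sigma, 0 < C &
       forall r : R, 0 < r ->
         (m [set u : H3 R | (r < L2normsq (Dx 2 u))%R] <=
          (C * expR (- (sigma * r ^+ 2)))%:E)%E]) /\
    (exists C' : R, 0 < C' /\
       forall eps : R, 0 < eps ->
         [/\ (m [set u : H3 R |
                 (enorm (u (2 * pi)) ^+ 2 / (4 * pi ^+ 2) < eps)%R] <=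
              (C' * eps)%:E)%E,
             (m [set u : H3 R |
                 (1 - enorm (u (2 * pi)) ^+ 2 / (4 * pi ^+ 2) < eps)%R] <=
              (C' * eps)%:E)%E &
             (m [set u : H3 R | (L2normsq (Dx 2 u) < eps)%R] <=
              (C' * eps)%:E)%E]) /\
    (exists C'' : R, 0 < C'' /\
       forall A : set R, measurable A ->
         (m [set u : H3 R | A (L2normsq (Dx 2 u))] <=
          C''%:E * lebesgue_measure A)%E) /\
    (forall K : set (H3 R), compact K ->
       (hausdorff_dim K < 2%:E)%E -> m K = 0%E).
Proof.
have [C2 C20 hC2] := @soliton_law_energy R.
have [C1 [C10 hC1]] := @soliton_law_endpoint R.
exists soliton_law; split; first exact: soliton_law_bcf_invariant.
split.
  by exists 1, (expR 64); split => //; exact: soliton_law_gaussian.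
split.
  exists (C1 + C2); split; first exact: addr_gt0.
  move=> eps e0; have [h1 h2] := hC1 eps e0; split.
  - by apply: le_trans h1 _; rewrite lee_fin ler_pM2r// lerDl ltW.
  - by apply: le_trans h2 _; rewrite lee_fin ler_pM2r// lerDl ltW.
  - have -> : [set u : H3 R | L2normsq (Dx 2 u) < eps] =
        [set u : H3 R | `[0, eps[%classic (L2normsq (Dx 2 u))].
      by apply/seteqP; split => u /=; rewrite in_itv /= L2normsq_ge0.
    apply: le_trans (hC2 _ _) _; first exact: measurable_itv.
    rewrite lebesgue_measure_itv /= lte_fin e0 -EFinB subr0 -EFinM lee_fin.
    by rewrite ler_pM2r// lerDr ltW.
split; first by exists C2.
by move=> K cK; exact: soliton_law_dim.
Qed.
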